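(* Let $T$ be a countable forest. (i) If $T$ is strongly contracting, has no finite dominating set, and $T\notin\mathcal{T}^*$, then $T$ is Ramsey-cofinite. (ii) If $T$ is weakly expanding, or has a finite dominating set, or $T\in\mathcal{T}^*$, then $T$ is not Ramsey-lower-dense (and hence not Ramsey-cofinite).
   Context: $K_{\mathbb{N}}$ is the complete graph on $\mathbb{N}=\{1,2,\dots\}$; a copy of $G$ is a subgraph of $K_\mathbb{N}$ isomorphic to $G$, monochromatic if all its edges have the same color. Lower density: $\underline{d}(V)=\liminf_{t\to\infty}|V\cap\{1,\dots,t\}|/t$. $G$ is Ramsey-cofinite if in every 2-coloring of the edges of $K_\mathbb{N}$ there is a monochromatic copy of $G$ whose vertex set is cofinite in $\mathbb{N}$. $G$ is Ramsey-lower-dense if in every 2-coloring of $K_\mathbb{N}$ there is a monochromatic copy of $G$ whose vertex set has positive lower density. $G$ is weakly expanding if for every $k\in\mathbb{N}$ there is $\ell\in\mathbb{N}$ such that every independent set $A$ of $G$ with $|A|\ge\ell$ satisfies $|N(A)|>k$, where $N(A)=\bigcup_{v\in A}N(v)$. $G$ is strongly contracting if there is $k\in\mathbb{N}$ such that for every $\ell\in\mathbb{N}$ there is an independent set $A$ with $|A|\ge\ell$ and $|N(A)|\le k$. A set $X\subseteq V(G)$ is dominating if every vertex outside $X$ has a neighbor in $X$. $\mathcal{T}^*$ is the family of forests $T$ having a vertex $t$ of infinite degree such that, for some $d\in\mathbb{N}$, every other vertex has degree at most $d$, $t$ is adjacent to infinitely many leaves and infinitely many non-leaves, and all but finitely many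 vertices of $T$ are at distance at most $2$ from $t$. *)

(* Defs.v *)
From HB Require Import structures.
From mathcomp Require Import all_boot all_order all_algebra.
From mathcomp Require Import all_classical all_reals.
From mathcomp Require Import topology normedtype sequences.
From mathcomp Require Import Rstruct.

Set Implicit Arguments.
Unset Strict Implicit.
Unset Printing Implicit Defensive.
Import Order.TTheory GRing.Theory Num.Theory.

Local Open Scope classical_set_scope.

Definition atmost {T : Type} (k : nat) (S : set T) : Prop :=
  exists g : 'I_k -> T, forall x, S x -> exists i, g i = x.

Definition atleast {T : Type} (l : nat) (S : set T) : Prop :=
  exists g : 'I_l -> T, injective g /\ forall i, S (g i).

Definition finite_set' {T : Type} (S : set T) : Prop := exists k, atmost k S.

Definition simple_graph {V : Type} (adj : V -> V -> Prop) : Prop :=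
  (forall u v, adj u v -> adj v u) /\ (forall v, ~ adj v v).

Definition countable_vertices (V : Type) : Prop :=
  exists f : V -> nat, injective f.

Definition has_cycle {V : Type} (adj : V -> V -> Prop) : Prop :=
  exists (n : nat) (p : nat -> V),
    (3 <= n)%N /\
    (forall i j, (i < n)%N -> (j < n)%N -> p i = p j -> i = j) /\
    (forall i, (i.+1 < n)%N -> adj (p i) (p i.+1)) /\
    adj (p n.-1) (p 0%N).

Definition forest {V : Type} (adj : V -> V -> Prop) : Prop := ~ has_cycle adj.

Definition nbhd {V : Type} (adj : V -> V -> Prop) (v : V) : set V := [set u | adj v u].

Definition nbhd_set {V : Type} (adj : V -> V -> Prop) (A : set V) : set V :=
  [set u | exists2 v, A v & adj v u].

Definition independent {V : Type} (adj : V -> V -> Prop) (A : set V) : Prop :=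
  forall u v, A u -> A v -> ~ adj u v.

Definition weakly_expanding {V : Type} (adj : V -> V -> Prop) : Prop :=
  forall k : nat, exists l : nat, forall A : set V,
    independent adj A -> atleast l A -> ~ atmost k (nbhd_set adj A).

Definition strongly_contracting {V : Type} (adj : V -> V -> Prop) : Prop :=
  exists k : nat, forall l : nat, exists A : set V,
    independent adj A /\ atleast l A /\ atmost k (nbhd_set adj A).

Definition dominating {V : Type} (adj : V -> V -> Prop) (X : set V) : Prop :=
  forall v, ~ X v -> exists2 u, X u & adj v u.

Definition has_finite_dominating_set {V : Type} (adj : V -> V -> Prop) : Prop :=
  exists X : set V, finite_set' X /\ dominating adj X.

Definition leaf {V : Type} (adj : V -> V -> Prop) (u : V) : Prop :=
  atmost 1 (nbhd adj u) /\ exists w, adj u w.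

Definition in_Tstar {V : Type} (adj : V -> V -> Prop) : Prop :=
  forest adj /\
  exists t : V,
    (forall k, ~ atmost k (nbhd adj t)) /\
    (exists d : nat, forall v, v <> t -> atmost d (nbhd adj v)) /\
    (forall k, ~ atmost k [set u | adj t u /\ leaf adj u]) /\
    (forall k, ~ atmost k [set u | adj t u /\ ~ leaf adj u]) /\
    finite_set' [set v | ~ (v = t \/ adj t v \/ exists2 w, adj t w & adj w v)].

Definition edge_coloring (c : nat -> nat -> bool) : Prop :=
  forall x y, c x y = c y x.

(* a copy of G in K_N: an injective map into N = {1,2,...}; the copy is the
   image subgraph (vertex set = range f, edges = images of edges of G) *)
Definition copy {V : Type} (f : V -> nat) : Prop :=
  injective f /\ forall v, (1 <= f v)%N.

Definition monochromatic {V : Type} (adj : V -> V -> Prop)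
    (c : nat -> nat -> bool) (f : V -> nat) : Prop :=
  exists b : bool, forall u v, adj u v -> c (f u) (f v) = b.

Definition cofinite_in_N (W : set nat) : Prop :=
  exists n0 : nat, forall n, (n0 <= n)%N -> W n.

Definition density_ratio (W : set nat) (t : nat) : Rdefinitions.R :=
  (((\sum_(1 <= i < t.+1) (asbool (W i) : nat))%N)%:R / t%:R)%R.

Definition lower_density (W : set nat) : \bar Rdefinitions.R :=
  limn_einf (fun t => (density_ratio W t)%:E).

Definition Ramsey_cofinite {V : Type} (adj : V -> V -> Prop) : Prop :=
  forall c, edge_coloring c ->
    exists f : V -> nat, copy f /\ monochromatic adj c f /\ cofinite_in_N (range f).

Definition Ramsey_lower_dense {V : Type} (adj : V -> V -> Prop) : Prop :=
  forall c, edge_coloring c ->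
    exists f : V -> nat, copy f /\ monochromatic adj c f /\
      (0 < lower_density (range f))%E.

(* Main.v *)
(* Part (ii): cut N into blocks growing so fast that a vertex set missing almost
   all of infinitely many blocks has lower density 0, and colour xy, x < y, by
   p(block of x) + q(block of y) mod 2.  Taking for p + q the parity of the
   block of x, the parity of the block of y, or two independent bits of the two
   blocks handles the weakly expanding forests, those with a finite dominating
   set and those of T*, respectively.

   Part (i): a strongly contracting forest has infinitely many isolated vertices,
   or a vertex t with infinitely many leaf neighbours, or vertices with
   arbitrarily many leaf neighbours far from any finite set, or a vertex y with
   infinitely many neighbours that have arbitrarily many leaf neighbours.  In each
   case a monochromatic almost spanning copy is built by back and forth, the
   embedded part being a finite ancestor-closed subset of the rooted forest.
   The last case only needs infinite neighbourhoods; the others use an infinite set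
   K such that every vertex sends one colour, red or blue, to almost all of K, the
   vertices of K being red.  With R, B the sets of red and of blue vertices,
   finitely many vertices of R (of B) have infinitely many common red (blue)
   neighbours in K, and the colour of the copy depends on which of the other
   neighbourhoods between R and B are infinite.  If all of them are and every
   vertex is within distance 2 of a finite set, T not being in T* provides, besides
   the last type, two vertices t1, t2 of infinite degree whose images can be chosen
   so that their neighbourhoods together cover almost all of R or of B. *)
Require Import Defs.
From mathcomp Require Import all_boot boolp zify.

Set Implicit Arguments.
Unset Strict Implicit.
Unset Printing Implicit Defensive.

(** * Infinite sets of integers *)

(** Stated so that it yields a member outside any finite list of vertices or positions already in
    use. *)
Definition infS (T : eqType) (A : T -> Prop) : Prop :=
  forall s : seq T, exists x, x \notin s /\ A x.

Section InfiniteSets.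
Variable T : eqType.
Implicit Types (A B : T -> Prop) (s : seq T).

Lemma ninfS A : ~ infS A -> exists s, forall x, A x -> x \in s.
Proof.
move=> /existsNP[s /forallNP Hs]; exists s => x Ax.
by apply/negPn/negP => xs; apply: (Hs x).
Qed.

Lemma infS_but s A B : infS A -> (forall x, x \notin s -> A x -> B x) -> infS B.
Proof.
move=> iA AB u; have [x []] := iA (s ++ u).
by rewrite mem_cat negb_or => /andP[xs xu] Ax; exists x; split=> //; apply: AB.
Qed.

Lemma infS_sub A B : infS A -> (forall x, A x -> B x) -> infS B.
Proof. by move=> iA AB; apply: (infS_but (s := [::]) iA) => x _; apply: AB. Qed.

Lemma infS_or A B : infS (fun x => A x \/ B x) -> infS A \/ infS B.
Proof.
move=> iAB; apply: contrapT => /not_orP[/ninfS[s Hs] /ninfS[u Hu]].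
have [x []] := iAB (s ++ u); rewrite mem_cat negb_or => /andP[xs xu] [/Hs|/Hu].
- by rewrite (negPf xs).
- by rewrite (negPf xu).
Qed.

Lemma infS_pigeon (I : eqType) (r : seq I) A (R : I -> T -> Prop) :
  infS A -> (forall x, A x -> exists2 i, i \in r & R i x) ->
  exists2 i, i \in r & infS (fun x => A x /\ R i x).
Proof.
elim: r A => [|i r IH] A iA HA.
  by have [x [_ /HA[]]] := iA [::].
have /infS_or[] : infS (fun x => (A x /\ R i x) \/ (A x /\ ~ R i x)).
- by apply: infS_sub iA _ => x Ax; case: (pselect (R i x)); [left|right].
- by move=> H; exists i; rewrite ?mem_head.
- move=> /IH[|j jr Hj].
    move=> x [Ax nRi]; have [j] := HA _ Ax.
    by rewrite inE => /orP[/eqP-> /nRi//|jr Rj]; exists j.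
  by exists j; [rewrite inE jr orbT | apply: infS_sub Hj _ => x [[Ax _] Rj]].
Qed.

End InfiniteSets.

Lemma mem_bigmax (s : seq nat) x : x \in s -> x <= \max_(i <- s) i.
Proof. by move=> xs; apply: (@leq_bigmax_seq _ s xpredT (fun i => i)). Qed.

Lemma injective_unbounded (f : nat -> nat) n :
  injective f -> exists m, n <= f m.
Proof.
move=> f_inj; apply: contrapT => /forallNP H.
have u : uniq (map f (iota 0 n.+1)) by rewrite map_inj_uniq ?iota_uniq.
have : size (map f (iota 0 n.+1)) <= size (iota 0 n).
  apply: uniq_leq_size u _ => _ /mapP[m _ ->].
  by rewrite mem_iota add0n /= ltnNge; apply/negP/H.
by rewrite size_map !size_iota ltnn.
Qed.

Lemma infS_ge (A : nat -> Prop) n : infS A -> exists2 x, n <= x & A x.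
Proof.
move=> /(_ (iota 0 n))[x [+ Ax]].
by rewrite mem_iota add0n /= -leqNgt => nx; exists x.
Qed.

Lemma geq_infS (A : nat -> Prop) :
  (forall n, exists2 x, n <= x & A x) -> infS A.
Proof.
move=> H s; have [x sx Ax] := H (\max_(i <- s) i).+1; exists x; split=> //.
apply/negP => xs; by have := mem_bigmax xs; rewrite leqNgt sx.
Qed.

Lemma finite_seq (A : nat -> Prop) (s : seq nat) :
  (forall x, A x -> x \in s) -> exists u : seq nat, forall x, A x <-> x \in u.
Proof.
move=> H; exists [seq x <- s | `[< A x >]] => x.
rewrite mem_filter; split.
- by move=> Ax; rewrite (H _ Ax) andbT; apply/asboolP.
- by move=> /andP[/asboolP].
Qed.

(** Almost every [a] is assigned one neighbour in P: one that is at least [a] if there are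
    infinitely many, and the largest one otherwise. The fibre of [p] is then finite: apart from the
    numbers up to [p], its members have no neighbour in P beyond [p], so the hypothesis for F = {0,
    ..., p} confines them to a finite set. *)
Lemma finite_fibers (E : nat -> nat -> bool) (A P : nat -> Prop) :
  (forall F : seq nat, exists G : seq nat, forall a, A a -> a \notin G ->
     exists p, [/\ P p, p \notin F & E p a]) ->
  exists Fib : nat -> seq nat,
    (forall p a, a \in Fib p -> A a /\ E p a) /\
    exists G : seq nat, forall a, A a -> a \notin G -> exists2 p, P p & a \in Fib p.
Proof.
move=> H.
have [G0 HG0] := H [::].
pose good a p := [/\ P p, E p a & a <= p \/ (forall q, P q -> E q a -> q <= p)].
have ex_good a : A a -> a \notin G0 -> exists p, good a p.
  move=> Aa aG; have [iN|/ninfS[s Hs]] := pselect (infS (fun p => P p /\ E p a)).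
    by have [p ap [Pp Epa]] := infS_ge a iN; exists p; split=> //; left.
  have [p [Pp _ Epa]] := HG0 _ Aa aG.
  have ub q : `[< P q /\ E q a >] -> q <= \max_(i <- s) i.
    by move=> /asboolP/Hs/mem_bigmax.
  have ex : exists q, `[< P q /\ E q a >] by exists p; apply/asboolP.
  case: (ex_maxnP ex ub) => m /asboolP[Pm Ema] Hm; exists m; split=> //.
  by right=> q Pq Eqa; apply: Hm; apply/asboolP.
have [phi Hphi] : exists phi : nat -> nat,
    forall a, A a -> a \notin G0 -> good a (phi a).
  suff : forall a, exists p, A a -> a \notin G0 -> good a p by move=> /choice[f Hf]; exists f.
  move=> a.
  have [[Aa aG]|nA] := pselect (A a /\ a \notin G0).
    by have [p] := ex_good a Aa aG; exists p.
  by exists 0 => Aa aG; case: nA.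
have fin p : exists u : seq nat,
    forall a, [/\ A a, a \notin G0 & phi a = p] <-> a \in u.
  have [Gp HGp] := H (iota 0 p.+1).
  apply: (@finite_seq _ (iota 0 p.+1 ++ Gp)) => a [Aa aG pa].
  rewrite mem_cat; apply/orP.
  have [|aGp] := boolP (a \in Gp); first by right.
  have [q [Pq qp Eqa]] := HGp _ Aa aGp; left.
  have [_ _ [|Hmax]] := Hphi a Aa aG; rewrite ?pa.
    by rewrite mem_iota add0n ltnS.
  by rewrite mem_iota add0n ltnS -pa (Hmax _ Pq Eqa) in qp.
have [Fib HFib] := choice fin.
exists Fib; split.
- move=> p a /HFib[Aa aG pa]; split=> //.
  by have [_ Epa _] := Hphi a Aa aG; rewrite -pa.
- exists G0 => a Aa aG; exists (phi a); first by have [] := Hphi a Aa aG.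
  by apply/HFib.
Qed.

(* Greedily pick x_0 < x_1 < ..., every A_i being visited infinitely often at
   even times and infinitely often at odd times; P collects the even times. *)
Lemma split_family (A : nat -> nat -> Prop) :
  exists P : nat -> Prop, forall i, infS (A i) ->
    infS (fun x => A i x /\ P x) /\ infS (fun x => A i x /\ ~ P x).
Proof.
(* Time [k] serves the first component of the pair coded by [k./2]; the second component makes each
   index recur infinitely often at times of either parity. *)
pose idx (k : nat) : nat := if @unpickle (nat * nat)%type k./2 is Some ij then ij.1 else 0.
have [next Hnext] : exists next : nat * nat -> nat, forall ik,
    infS (A ik.1) -> ik.2 < next ik /\ A ik.1 (next ik).
  suff : forall ik : nat * nat, exists y, infS (A ik.1) -> ik.2 < y /\ A ik.1 y by move=> /choice[f Hf]; exists f.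
  move=> [i k]; have [iA|] := pselect (infS (A i)); last by exists 0.
  by have [y ky Ay] := infS_ge k.+1 iA; exists y.
pose step k x := if `[< infS (A (idx k)) >] then next (idx k, x) else x.+1.
pose fix x k : nat := if k is k'.+1 then step k (x k') else step 0 0.
have x_lt k : x k < x k.+1.
  rewrite /= /step; case: asboolP => // iA.
  by have [] := Hnext (idx k.+1, x k) iA.
have x_mono k l : k < l -> x k < x l.
  elim: l => // l IH; rewrite ltnS leq_eqVlt => /orP[/eqP->//|/IH kl].
  exact: ltn_trans kl (x_lt l).
have x_inj k l : x k = x l -> k = l.
  by move=> e; case: (ltngtP k l) => // /x_mono; rewrite e ltnn.
have x_ge k : k <= x k by elim: k => // k IH; apply: leq_ltn_trans IH (x_lt k).
have x_in k : infS (A (idx k)) -> A (idx k) (x k).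
  move=> iA; case: k iA => [|k] iA; rewrite /= /step; case: asboolP => // _.
    by have [] := Hnext (idx 0, 0) iA.
  by have [] := Hnext (idx k.+1, x k) iA.
exists (fun y => exists2 k, ~~ odd k & y = x k) => i iA.
have visit (b : bool) n : exists k, [/\ n <= k, odd k = b & idx k = i].
  have pair_inj : injective (fun m : nat => pickle (i, m)).
    by move=> m m' /(pcan_inj pickleK)[].
  have [m nm] := injective_unbounded n pair_inj.
  exists (b + (pickle (i, m)).*2); split.
  - by apply: leq_trans nm _; rewrite -addnn addnCA leq_addr.
  - by rewrite oddD odd_double addbF; case: b.
  - by rewrite /idx half_bit_double pickleK.
split; apply: geq_infS => n.
- have [k [nk ok ik]] := visit false n; exists (x k).
    exact: leq_trans nk (x_ge k).
  by split; [rewrite -ik; apply: x_in; rewrite ik | exists k; rewrite ?ok].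
- have [k [nk ok ik]] := visit true n; exists (x k).
    exact: leq_trans nk (x_ge k).
  split; first by rewrite -ik; apply: x_in; rewrite ik.
  by move=> [l ol /x_inj kl]; rewrite -kl ok in ol.
Qed.

(** * Extending finite partial embeddings of a rooted forest *)

Section RootedForest.
Variables (V : eqType) (par : V -> option V) (dep : V -> nat).
Hypothesis dep_par : forall v u, par v = Some u -> dep v = (dep u).+1.
Implicit Types (u v x y : V) (D : seq V).

Definition nochild v : Prop := forall u, par u <> Some v.

(** The childless children are a reserve: no class restriction applies to them, so a rich vertex can
    absorb finitely many prescribed neighbours of its position. *)
Definition rich (l : nat) v : Prop :=
  exists L : seq V, [/\ uniq L, l <= size L & forall x, x \in L -> par x = Some v /\ nochild x].

Fixpoint anc (j : nat) v : option V :=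
  if j is j'.+1 then obind par (anc j' v) else Some v.

(* [far j D v]: none of the first j vertices on the way up from v is in D (the
   way up may end before). *)
Fixpoint far (j : nat) (D : seq V) v : Prop :=
  if j is j'.+1 then
    v \notin D /\ (if par v is Some u then far j' D u else True)
  else True.

Lemma par_irrefl v : par v <> Some v.
Proof. by move=> /dep_par/eqP; rewrite eqn_leq ltnn andbF. Qed.

(** Locates where a chain leading down to [v] has to start: at a root, free of constraints, or at
    the [j]-th ancestor, whose parent is embedded first. *)
Lemma far_chain j D v : far j.+1 D v ->
  (exists i x, [/\ i <= j, anc i v = Some x, par x = None & x \notin D]) \/
  (exists x u, [/\ anc j v = Some x, par x = Some u & x \notin D]).
Proof.
have ancS i w u : par w = Some u -> anc i.+1 w = anc i u.
  by move=> e; elim: i => [|i IH]; [rewrite /= e | rewrite [LHS]/= -/(anc i.+1 w) IH].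
elim: j v => [|j IH] v /=.
  case e : (par v) => [u|] [vD _]; first by right; exists v, u.
  by left; exists 0, v.
move=> [vD]; case e : (par v) => [u|]; last by left; exists 0, v.
move=> /IH[[i [x [ij ax px xD]]]|[x [w [ax px xD]]]].
- by left; exists i.+1, x; rewrite (ancS _ _ _ e).
- by right; exists x, w; rewrite -[obind _ _]/(anc j.+1 v) (ancS _ _ _ e).
Qed.

End RootedForest.

(** * Finite partial embeddings and the back-and-forth argument *)

Section Embedding.
Variables (V : eqType) (idx : V -> nat) (par : V -> option V) (dep : V -> nat).
Variable cl : V -> bool.
Hypothesis idx_inj : injective idx.
Hypothesis dep_par : forall v u, par v = Some u -> dep v = (dep u).+1.
Hypothesis cl_par : forall v u, par v = Some u -> cl v = ~~ cl u.

(* E is the edge relation of one colour; Z b is the set of positions allowed for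
   the vertices of class b (childless vertices may sit anywhere), from which G b
   is used by default; whenever a vertex sits at a position p in P, the positions
   in Fib p are occupied too. *)
Variable E : nat -> nat -> bool.
Variables Z G : bool -> nat -> Prop.
Variable P : nat -> Prop.
Variable Fib : nat -> seq nat.
Hypothesis GZ : forall b n, G b n -> [/\ Z b n, ~ P n & 0 < n].
Hypothesis G_nbr : forall b m, Z (~~ b) m -> infS (fun n => G b n /\ E m n).
Hypothesis G_inf : forall b, infS (G b).
Hypothesis Fib_ok : forall p b, P p -> b \in Fib p -> [/\ E p b, ~ P b & 0 < b].

Implicit Types (u v x y : V) (S : seq (V * nat)) (a : option nat) (F : seq nat).

Notation dom S := (unzip1 S).
Notation ran S := (unzip2 S).

(** [raw_par] keeps the domain closed under ancestors, so a new vertex has no child in the domain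
    and only the edge to its parent has to be respected. *)
Record raw S : Prop := Raw {
  raw_dom : uniq (dom S);
  raw_ran : uniq (ran S);
  raw_pos : forall n, n \in ran S -> 0 < n;
  raw_par : forall v n u, (v, n) \in S -> par v = Some u ->
    exists m, (u, m) \in S /\ E m n;
  raw_ok : forall v n, (v, n) \in S -> Z (cl v) n \/ nochild par v }.

(** The condition on fibres is kept apart because it may fail while the fibre of a newly occupied
    position is being filled. *)
Definition valid S : Prop :=
  raw S /\ forall n b, n \in ran S -> P n -> b \in Fib n -> b \in ran S.

Definition anchored S v a : Prop :=
  if par v is Some u then exists m, (u, m) \in S /\ a = Some m else a = None.

Definition ea a n : bool := if a is Some m then E m n else true.

Definition ready S v w : Prop :=
  [/\ v \notin dom S, w \notin ran S & exists2 a, anchored S v a & ea a w].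

Definition okA (b : bool) a : Prop := if a is Some m then Z (~~ b) m else True.

(** Positions for a chain of [j] new vertices, of alternating classes starting with [b], leading
    from the position [a] of the parent ([None] for a root) to the prescribed position [w] of the
    vertex below the chain; F lists the positions in use. *)
Fixpoint walk (j : nat) (b : bool) a (w : nat) F : Prop :=
  if j is j'.+1 then
    exists n, [/\ n \notin F, n != w, [/\ Z b n, ~ P n & 0 < n], ea a n &
               walk j' (~~ b) (Some n) w (n :: F)]
  else ea a w.

Lemma mem_dom S v n : (v, n) \in S -> v \in dom S.
Proof. by move=> vn; apply/mapP; exists (v, n). Qed.

Lemma mem_ran S v n : (v, n) \in S -> n \in ran S.
Proof. by move=> vn; apply/mapP; exists (v, n). Qed.

Lemma domP S v : v \in dom S -> exists n, (v, n) \in S.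
Proof. by move=> /mapP[[u n] un /= ->]; exists n. Qed.

Lemma ranP S n : n \in ran S -> exists v, (v, n) \in S.
Proof. by move=> /mapP[[u m] um /= ->]; exists u. Qed.

Lemma sub_dom S S' : {subset S <= S'} -> {subset dom S <= dom S'}.
Proof. by move=> SS' v /domP[n /SS'/mem_dom]. Qed.

Lemma sub_ran S S' : {subset S <= S'} -> {subset ran S <= ran S'}.
Proof. by move=> SS' n /ranP[v /SS'/mem_ran]. Qed.

Lemma raw_dom_par S v u : raw S -> v \in dom S -> par v = Some u -> u \in dom S.
Proof. by move=> rS /domP[n vn] /(raw_par rS vn)[m [/mem_dom]]. Qed.

Lemma anchored_okA S v a : raw S -> anchored S v a -> okA (cl v) a.
Proof.
rewrite /anchored => rS; case e : (par v) => [u|]; last by move=> ->.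
move=> [m [um ->]] /=.
by have [|/(_ _ e)//] := raw_ok rS um; rewrite (cl_par e) negbK.
Qed.

Lemma raw_cons S v w : raw S -> ready S v w -> 0 < w ->
  Z (cl v) w \/ nochild par v -> raw ((v, w) :: S).
Proof.
move=> rS [vS wS [a av aw]] w0 ok; split=> /=.
- by rewrite vS raw_dom.
- by rewrite wS raw_ran.
- by move=> n; rewrite inE => /orP[/eqP->//|/(raw_pos rS)].
- move=> x n u; rewrite inE => /orP[/eqP[-> ->]|xn] pu.
    move: av; rewrite /anchored pu => -[m [um am]]; exists m.
    by rewrite inE um orbT; split=> //; rewrite am in aw.
  by have [m [um mn]] := raw_par rS xn pu; exists m; rewrite inE um orbT.
- by move=> x n; rewrite inE => /orP[/eqP[-> ->]//|/(raw_ok rS)].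
Qed.

Lemma valid_cons S v w : valid S -> ready S v w -> 0 < w ->
  Z (cl v) w \/ nochild par v -> ~ P w -> valid ((v, w) :: S).
Proof.
move=> [rS pS] vw w0 ok nP; split; first exact: raw_cons.
move=> n b; rewrite /= !inE => /orP[/eqP->//|nS Pn bF].
by rewrite (pS n) ?orbT.
Qed.

Lemma sub_cons S p : {subset S <= p :: S}.
Proof. by move=> x; rewrite inE orbC => ->. Qed.

Lemma valid_nil : valid [::].
Proof. by split=> //; split. Qed.

Lemma valid_root v m : par v = None -> 0 < m -> Z (cl v) m -> ~ P m ->
  valid [:: (v, m)].
Proof.
move=> pv m0 Zm nPm; apply: (valid_cons valid_nil) => //; last by left.
by split=> //; exists None; rewrite // /anchored pv.
Qed.

(** Missing ancestors are placed first, by induction on the depth; [G_nbr] then offers infinitely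
    many positions for [v]. The depth bound in the last clause guarantees that no proper descendant
    of [v] is added. *)
Lemma extend_default S v F : valid S -> exists S',
  [/\ {subset S <= S'}, valid S', v \in dom S' &
      forall x n, (x, n) \in S' ->
        (x, n) \in S \/ [/\ n \notin F, G (cl x) n & dep x <= dep v]].
Proof.
have [k] := ubnP (dep v); elim: k v S => // k IH v S; rewrite ltnS => kv vS.
have [vD|vD] := boolP (v \in dom S); first by exists S; split=> // x n; left.
have [S1 [SS1 vS1 newS1 vD1 [a av]]] : exists S1, [/\ {subset S <= S1}, valid S1,
    forall x n, (x, n) \in S1 ->
      (x, n) \in S \/ [/\ n \notin F, G (cl x) n & dep x <= dep v],
    v \notin dom S1 & exists a, anchored S1 v a].
  case e : (par v) => [u|]; last first.
    exists S; split=> //; first by move=> x n; left.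
    by exists None; rewrite /anchored e.
  have dvu := dep_par e.
  have [||S1 [SS1 vS1 uS1 newS1]] := IH u S; rewrite -?dvu //.
  exists S1; split=> //.
  - move=> x n /newS1[|[nF Gn dx]]; first by left.
    by right; split=> //; rewrite dvu; apply: leqW.
  - apply/negP => /domP[n /newS1[/mem_dom|[_ _]]]; first by rewrite (negPf vD).
    by rewrite dvu ltnn.
  - by have [m um] := domP uS1; exists (Some m); rewrite /anchored e; exists m.
have /(_ (F ++ ran S1))[n [nF [Gn an]]] : infS (fun n => G (cl v) n /\ ea a n).
  case: a av => [m|] av /=; last by apply: infS_sub (G_inf (cl v)) _.
  by apply: G_nbr; apply: anchored_okA av; case: vS1.
move: nF; rewrite mem_cat negb_or => /andP[nF nS1].
have [Zn nPn n0] := GZ Gn.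
exists ((v, n) :: S1); split.
- by move=> x /SS1 xS; rewrite inE xS orbT.
- by apply: valid_cons => //; [split=> //; exists a | left].
- by rewrite /= mem_head.
- by move=> x m; rewrite inE => /orP[/eqP[-> ->]|/newS1//]; right; split.
Qed.

Lemma walk_sub j b a a' w F F' : {subset F' <= F} ->
  (forall n, ea a n -> ea a' n) -> walk j b a w F -> walk j b a' w F'.
Proof.
elim: j b a a' F F' => [|j IH] b a a' F F' FF' aa' /=; first exact: aa'.
move=> [n [nF nw Zn an H]]; exists n; split=> //; last 1 first.
- apply: IH H => // x; rewrite !inE => /orP[->//|/FF'->]; exact: orbT.
- by apply: contra nF; apply: FF'.
- exact: aa'.
Qed.

(** A walk without a starting constraint may lose its first positions; this serves chains that reach
    a root in fewer than [j] steps. *)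
Lemma walk_None i j b w F : i <= j ->
  walk j (iter j negb b) None w F -> walk i (iter i negb b) None w F.
Proof.
move=> /subnK <-; elim: (j - i) => // k IH /= [n [_ _ _ _ H]]; apply: IH.
rewrite negbK in H; apply: walk_sub H => // x xF.
by rewrite inE xF orbT.
Qed.

Lemma cl_anc i v x : anc par i v = Some x -> cl x = iter i negb (cl v).
Proof.
elim: i x => [|i IH] x /=; first by move=> [->].
case: (anc par i v) IH => //= u /(_ _ erefl) <- /cl_par ->.
by rewrite negbK.
Qed.

(** The chain from [x] down to [v] takes the positions of the walk one by one; closure of the domain
    under ancestors keeps the rest of the chain outside it. *)
Lemma place_along j v x a w S : valid S -> anc par j v = Some x ->
  x \notin dom S -> anchored S x a -> w \notin ran S ->
  walk j (cl x) a w (ran S) ->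
  exists S', [/\ {subset S <= S'}, valid S', ready S' v w &
    forall y n, (y, n) \in S' -> (y, n) \in S \/ Z (cl y) n].
Proof.
elim: j x a S => [|j IH] x a S vS /=.
  move=> [->] xS ax wS aw; exists S; split=> //; last by left.
  by split=> //; exists a.
case e : (anc par j v) => [x'|//] /= px' xS ax wS [n [nS nw [Zn nPn n0] an H]].
have vS' : valid ((x, n) :: S).
  by apply: valid_cons => //; [split=> //; exists a | left].
have [||||S' [SS' vS'' rS' newS']] := IH x' (Some n) _ vS' e.
- rewrite /= inE negb_or; apply/andP; split.
    by apply/eqP => xx'; rewrite xx' in px'; case: (par_irrefl dep_par px').
  by apply: contra xS => /raw_dom_par/(_ px'); apply; case: vS.
- by rewrite /anchored px'; exists n; rewrite mem_head.
- by rewrite /= inE negb_or eq_sym nw.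
- by rewrite (cl_par px').
exists S'; split=> // [y yS|y m /newS'[|]]; last by right.
- exact/SS'/sub_cons.
- by rewrite inE => /orP[/eqP[-> ->]|]; [right|left].
Qed.

(** Lets [w] be prescribed as the position of [v]. If the way up ends early, the chain starts at a
    root; otherwise the parent of the [j]-th ancestor is embedded first, away from [w], and the walk
    starts there. *)
Lemma place_far j v w S : valid S -> far par j.+1 (dom S) v -> w \notin ran S ->
  (forall a F, okA (iter j negb (cl v)) a -> walk j (iter j negb (cl v)) a w F) ->
  exists S', [/\ {subset S <= S'}, valid S', ready S' v w &
    forall y n, (y, n) \in S' -> (y, n) \in S \/ Z (cl y) n].
Proof.
move=> vS /far_chain[[i [x [ij ax px xS]]]|[x [u [ax px xS]]]] wS H.
- apply: (place_along (a := None) vS ax xS) => //; first by rewrite /anchored px.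
  by rewrite (cl_anc ax); apply: walk_None ij _; apply: H.
- have [S1 [SS1 vS1 uS1 newS1]] := extend_default u [:: w] vS.
  have [m um] := domP uS1.
  have xS1 : x \notin dom S1.
    apply/negP => /domP[n /newS1[/mem_dom|[_ _]]]; first by rewrite (negPf xS).
    by rewrite (dep_par px) ltnn.
  have wS1 : w \notin ran S1.
    apply/negP => /ranP[y /newS1[/mem_ran|[]]]; first by rewrite (negPf wS).
    by rewrite mem_head.
  have ax1 : anchored S1 x (Some m) by rewrite /anchored px; exists m.
  have [|S2 [S12 vS2 rS2 newS2]] := place_along vS1 ax xS1 ax1 wS1.
    rewrite (cl_anc ax); apply: H.
    by have := anchored_okA (proj1 vS1) ax1; rewrite (cl_anc ax).
  exists S2; split=> // [y /SS1/S12//|y n /newS2[/newS1[|[_ /GZ[]]]|]];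
    by [left|right].
Qed.

(** Items not yet occupied go to distinct childless children, on which the class sets impose
    nothing. No item lies in P, so no further fibre has to be filled. *)
Lemma fill_children v p items L S : raw S -> (v, p) \in S ->
  (forall b, b \in items -> [/\ E p b, ~ P b & 0 < b]) ->
  uniq L -> size items <= size L ->
  (forall x, x \in L -> [/\ par x = Some v, nochild par x & x \notin dom S]) ->
  exists S', [/\ {subset S <= S'}, raw S', {subset items <= ran S'} &
    forall n, n \in ran S' -> P n -> n \in ran S].
Proof.
elim: items L S => [|b items IH] L S rS vp.
  by move=> *; exists S; split=> // x; rewrite in_nil.
move=> Hb uL sL HL.
have Hit b' : b' \in items -> [/\ E p b', ~ P b' & 0 < b'].
  by move=> b'i; apply: Hb; rewrite inE b'i orbT.
have [bS|bS] := boolP (b \in ran S).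
  have [S' [SS' rS' iS' nS']] := IH L S rS vp Hit uL (ltnW sL) HL.
  exists S'; split=> // x; rewrite inE => /orP[/eqP->|/iS'//].
  exact: sub_ran SS' _ bS.
case: L uL sL HL => // x L /= /andP[xL uL] sL HL.
have [Epb nPb b0] := Hb b (mem_head _ _).
have [px nx xS] := HL x (mem_head _ _).
have rS1 : raw ((x, b) :: S).
  apply: raw_cons => //; last by right.
  by split=> //; exists (Some p); rewrite // /anchored px; exists p.
have [||S' [SS' rS' iS' nS']] := IH L _ rS1 _ Hit uL sL.
- exact: sub_cons.
- move=> y yL; have [|py ny yS] := HL y; first by rewrite inE yL orbT.
  split=> //; rewrite /= inE negb_or yS andbT.
  by apply: contraNneq xL => <-.
exists S'; split=> //.
- by move=> y yS; apply/SS'/sub_cons.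
- move=> y; rewrite inE => /orP[/eqP->|/iS'//].
  by apply: (sub_ran SS'); rewrite /= mem_head.
- by move=> n nS Pn; have := nS' n nS Pn; rewrite /= inE => /orP[/eqP nb|//]; rewrite -nb in nPb.
Qed.

(** Occupying [p] by [v] obliges the fibre of [p] to be occupied too; it goes to the childless
    children of [v], which are new because [v] is. *)
Lemma host v p S : valid S -> ready S v p -> 0 < p -> Z (cl v) p ->
  rich par (size (Fib p)) v -> P p ->
  exists S', [/\ {subset S <= S'}, valid S', p \in ran S' &
                 {subset Fib p <= ran S'}].
Proof.
move=> [rS pS] vp p0 Zp [L [uL sL HL]] Pp.
have rS1 : raw ((v, p) :: S) by apply: raw_cons => //; left.
have [||S' [SS' rS' iS' nS']] := fill_children rS1 (mem_head _ _) _ uL sL.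
- by move=> b; apply: Fib_ok.
- move=> x xL; have [px nx] := HL x xL; split=> //.
  rewrite /= inE negb_or; apply/andP; split.
    by apply/eqP => xv; rewrite xv in px; case: (par_irrefl dep_par px).
  case: vp => vS _ _; apply: contra vS => xS; exact: raw_dom_par rS xS px.
have SS1 : {subset S <= S'} by move=> y yS; apply/SS'/sub_cons.
have pS' : p \in ran S' by apply: (sub_ran SS'); rewrite /= mem_head.
exists S'; split=> //; split=> // n b nS Pn bF.
have := nS' n nS Pn; rewrite /= inE => /orP[/eqP np|nS0].
- by apply: iS'; rewrite -np.
- by apply: (sub_ran SS1); apply: pS nS0 Pn bF.
Qed.

Lemma place v w S : valid S -> ready S v w -> 0 < w ->
  Z (cl v) w \/ nochild par v -> ~ P w ->
  exists S', [/\ {subset S <= S'}, valid S' & w \in ran S'].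
Proof.
move=> vS vw w0 ok nP; exists ((v, w) :: S); split; last by rewrite /= mem_head.
- exact: sub_cons.
- exact: valid_cons.
Qed.

(** Stage [k] embeds the vertex of index [k], if it is missing, and then covers the number [k] if it
    belongs to W. The lists increase, and their union is the graph of [f]. *)
Lemma back_and_forth (W : nat -> Prop) S0 : valid S0 ->
  (forall S w, valid S -> {subset S0 <= S} -> W w -> w \notin ran S ->
     exists S', [/\ {subset S <= S'}, valid S' & w \in ran S']) ->
  exists f : V -> nat, [/\ injective f, forall v, 0 < f v,
    forall v u, par v = Some u -> E (f u) (f v) &
    forall w, W w -> exists v, f v = w].
Proof.
move=> vS0 HW.
have step (kS : nat * {S | valid S /\ {subset S0 <= S}}) :
    exists S' : {S | valid S /\ {subset S0 <= S}},
    [/\ {subset sval kS.2 <= sval S'},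
        forall v, idx v = kS.1 -> v \in dom (sval S') &
        W kS.1 -> kS.1 \in ran (sval S')].
  case: kS => k [S [vS S0S]] /=.
  have [S1 [SS1 vS1 kS1]] : exists S1, [/\ {subset S <= S1}, valid S1 &
      forall v, idx v = k -> v \in dom S1].
    have [[v vk]|nv] := pselect (exists v, idx v = k); last first.
      by exists S; split=> // v vk; case: nv; exists v.
    have [S1 [SS1 vS1 vS1' _]] := extend_default v [::] vS.
    by exists S1; split=> // u; rewrite -vk => /idx_inj ->.
  have S0S1 : {subset S0 <= S1} by move=> x /S0S/SS1.
  have [S2 [S12 vS2 kS2]] : exists S2, [/\ {subset S1 <= S2}, valid S2 &
      W k -> k \in ran S2].
    have [Wk|nWk] := pselect (W k); last by exists S1; split=> // Wk.
    have [kS|kS] := boolP (k \in ran S1); first by exists S1; split.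
    by have [S2 [? ? ?]] := HW S1 k vS1 S0S1 Wk kS; exists S2.
  have S02 : {subset S0 <= S2} by move=> x /S0S1/S12.
  exists (exist _ S2 (conj vS2 S02)); split=> //=.
  - by move=> x /SS1/S12.
  - by move=> v /kS1; apply: sub_dom.
have [next Hnext] := choice step.
have start : valid S0 /\ {subset S0 <= S0} by split.
pose st := fix st k := if k is k'.+1 then next (k', st k')
                       else exist (fun S => valid S /\ {subset S0 <= S}) S0 start.
have st_mono k l : k <= l -> {subset sval (st k) <= sval (st l)}.
  elim: l => [|l IH]; first by rewrite leqn0 => /eqP->.
  rewrite leq_eqVlt => /orP[/eqP->//|/IH kl x /kl xs].
  by have [H _ _] := Hnext (l, st l); apply: H.
have total v : exists n, (v, n) \in sval (st (idx v).+1).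
  by have [_ H _] := Hnext (idx v, st (idx v)); apply/domP/H.
have [f Hf] := choice total.
have common u v : exists S, [/\ valid S, (u, f u) \in S & (v, f v) \in S].
  exists (sval (st (maxn (idx u).+1 (idx v).+1))); split.
  - by case: (svalP (st (maxn (idx u).+1 (idx v).+1))).
  - by apply: st_mono (Hf u); apply: leq_maxl.
  - by apply: st_mono (Hf v); apply: leq_maxr.
have fun_S S u m n : valid S -> (u, m) \in S -> (u, n) \in S -> m = n.
  move=> [rS _]; have := raw_dom rS; elim: S {rS} => // -[x k] S IH /= /andP[xS uS].
  rewrite !inE => /orP[/eqP[ux mk]|um] /orP[/eqP[ux' nk]|un].
  - by rewrite mk nk.
  - by move: xS; rewrite -ux (mem_dom un).
  - by move: xS; rewrite -ux' (mem_dom um).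
  - exact: IH.
have inj_S S u v m : valid S -> (u, m) \in S -> (v, m) \in S -> u = v.
  move=> [rS _]; have := raw_ran rS; elim: S {rS} => // -[x k] S IH /= /andP[kS uS].
  rewrite !inE => /orP[/eqP[ux mk]|um] /orP[/eqP[vx mk']|vm].
  - by rewrite ux vx.
  - by move: kS; rewrite -mk (mem_ran vm).
  - by move: kS; rewrite -mk' (mem_ran um).
  - exact: IH.
exists f; split.
- move=> u v fuv; have [S [vS uS vS']] := common u v.
  by rewrite fuv in uS; apply: inj_S vS uS vS'.
- by move=> v; have [S [[rS _] /mem_ran/(raw_pos rS)]] := common v v.
- move=> v u pu; have [S [vS vS' uS]] := common v u.
  have [m [um Emn]] := raw_par (proj1 vS) vS' pu.
  by rewrite (fun_S _ _ _ _ vS uS um).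
- move=> w Ww; have [_ _ /(_ Ww)/ranP[v vw]] := Hnext (w, st w).
  exists v; have [S [vS fv _]] := common v v.
  have vst := st_mono _ _ (leq_maxl w.+1 (idx v).+1) _ vw.
  have fst := st_mono _ _ (leq_maxr w.+1 (idx v).+1) _ (Hf v).
  have [vS' _] := svalP (st (maxn w.+1 (idx v).+1)).
  exact: fun_S vS' fst vst.
Qed.

End Embedding.

Lemma valid_sub_Z (V : eqType) (par : V -> option V) (cl : V -> bool)
    (E : nat -> nat -> bool) (Z Z' : bool -> nat -> Prop) P Fib S :
  (forall e n, Z e n -> Z' e n) ->
  valid par cl E Z P Fib S -> valid par cl E Z' P Fib S.
Proof.
move=> ZZ' [[? ? ? ? ok] pend]; split=> //; split=> // v n /ok[]; last by right.
by left; apply: ZZ'.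
Qed.

(** * A root with infinitely many rich children *)

Definition spans (V : Type) (par : V -> option V) (c : nat -> nat -> bool) : Prop :=
  exists (b : bool) (f : V -> nat) (s : seq nat), [/\ injective f, forall v, 0 < f v,
    forall v u, par v = Some u -> c (f u) (f v) = b &
    forall w, 0 < w -> w \notin s -> exists v, f v = w].

Section RichRoot.
Variables (V : eqType) (idx : V -> nat) (par : V -> option V) (dep : V -> nat).
Variable cl : V -> bool.
Hypothesis idx_inj : injective idx.
Hypothesis dep_par : forall v u, par v = Some u -> dep v = (dep u).+1.
Hypothesis cl_par : forall v u, par v = Some u -> cl v = ~~ cl u.
Variable y0 : V.
Hypothesis y0_root : par y0 = None.
Hypothesis y0_rich : forall l, infS (fun x => par x = Some y0 /\ rich par l x).

(** The root [y0] sits at [m]. A neighbour of [m] in Z is covered by a fresh child of [y0]; any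
    other number lies in the fibre of some [p] in P and is covered by placing a sufficiently rich
    child of [y0] at [p]. *)
Lemma rich_root_embedding (E : nat -> nat -> bool) (Z P W : nat -> Prop)
    (Fib : nat -> seq nat) m :
  (forall z, Z z -> 0 < z) -> Z m -> ~ P m ->
  (forall z, Z z -> infS (fun n => [/\ Z n, ~ P n & E z n])) ->
  (forall p, P p -> Z p /\ E m p) ->
  (forall p b, P p -> b \in Fib p -> [/\ E p b, ~ P b & 0 < b]) ->
  (forall w, W w -> w = m \/ (Z w /\ E m w) \/ exists2 p, P p & w \in Fib p) ->
  exists f : V -> nat, [/\ injective f, forall v, 0 < f v,
    forall v u, par v = Some u -> E (f u) (f v) &
    forall w, W w -> exists v, f v = w].
Proof.
move=> Zpos Zm Pm Znbr Pm1 Fib_ok HW.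
pose Zb (_ : bool) := Z; pose G (_ : bool) n := Z n /\ ~ P n.
have GZ b n : G b n -> [/\ Zb b n, ~ P n & 0 < n].
  by move=> [Zn nP]; split=> //; apply: Zpos.
have G_nbr b z : Zb (~~ b) z -> infS (fun n => G b n /\ E z n).
  by move=> Zz; apply: infS_sub (Znbr z Zz) _ => n [].
have G_inf b : infS (G b).
  by apply: infS_sub (Znbr m Zm) _ => n [].
pose S0 := [:: (y0, m)].
have vS0 : valid par cl E Zb P Fib S0.
  by apply: valid_root => //; apply: Zpos.
apply: (back_and_forth idx_inj dep_par cl_par GZ G_nbr G_inf vS0) => S w vS S0S Ww wS.
have y0m : (y0, m) \in S by apply: S0S; rewrite mem_head.
have child x l q : q \notin unzip2 S -> E m q -> x \notin unzip1 S ->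
    par x = Some y0 /\ rich par l x -> ready par E S x q.
  move=> qS Emq xS [px _]; split=> //; exists (Some m) => //.
  by rewrite /anchored px; exists m.
have cover_P p : P p -> p \notin unzip2 S -> exists S',
    [/\ {subset S <= S'}, valid par cl E Zb P Fib S', p \in unzip2 S' &
        {subset Fib p <= unzip2 S'}].
  move=> Pp pS; have [Zp Emp] := Pm1 p Pp.
  have [x [xS Hx]] := y0_rich (size (Fib p)) (unzip1 S).
  apply: (host dep_par Fib_ok vS (child x _ p pS Emp xS Hx)) => //.
    exact: Zpos.
  by case: Hx.
case: (HW w Ww) => [wm|[[Zw Emw]|[p Pp wp]]].
- by rewrite wm (mem_ran y0m) in wS.
- have [/cover_P/(_ wS)[S' [? ? ? _]]|nPw] := pselect (P w); first by exists S'.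
  have [x [xS Hx]] := y0_rich 0 (unzip1 S).
  by apply: (place vS (child x _ w wS Emw xS Hx)) => //; [apply: Zpos|left].
- have [pS|pS] := boolP (p \in unzip2 S).
    by case: vS => _ /(_ p w pS Pp wp); rewrite (negPf wS).
  by have [S' [? ? _ H]] := cover_P p Pp pS; exists S'; split=> //; apply: H.
Qed.

Variable c : nat -> nat -> bool.
Hypothesis c_sym : forall x y, c x y = c y x.

(** Half of these vertices become the hosts P, the other half the default positions, and one of
    them, [q0], carries the root. Each host is joined in colour [b] to almost all numbers, so
    [finite_fibers] applies. *)
Lemma rich_root_spans_saturated (b : bool) :
  infS (fun q => 0 < q /\ exists s : seq nat, forall x, x \notin s -> c q x = b) ->
  spans par c.
Proof.
set Q := (X in infS X) => iQ.
have [q0 [_ [q0_pos [s0 Hs0]]]] := iQ [::].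
have [A HA] := split_family (fun=> Q).
have [iQA iQnA] := HA 0 iQ.
pose E x y := c x y == b.
pose P q := [/\ Q q, A q & q \notin q0 :: s0].
have iP : infS P.
  by apply: (infS_but (s := q0 :: s0) iQA) => q qs [Qq Aq]; split.
have [|Fib [HFib [G HG]]] := @finite_fibers E (fun n => 0 < n /\ ~ P n) P.
  move=> F; have [p [pF Pp]] := iP F; have [[_ [s Hs]] _ _] := Pp.
  by exists s => a _ aG; exists p; split=> //; rewrite /E Hs.
have [|||||||f [f_inj f0 fE fW]] := @rich_root_embedding E Q P
    (fun w => 0 < w /\ w \notin G) Fib q0.
- by move=> z [].
- by split=> //; exists s0.
- by move=> [_ _]; rewrite mem_head.
- move=> z [_ [s Hs]]; apply: (infS_but (s := s) iQnA) => n ns [Qn nAn].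
  by split=> //; [case|rewrite /E Hs].
- move=> p [Qp _]; rewrite inE negb_or => /andP[_ ps]; split=> //.
  by rewrite /E Hs0.
- by move=> p x Pp /HFib[[x0 nPx] Epx].
- move=> w [w0 wG]; have [Pw|nPw] := pselect (P w).
    right; left; case: Pw => Qw _; rewrite inE negb_or => /andP[_ ws].
    by split=> //; rewrite /E Hs0.
  by right; right; apply: HG wG.
exists b, f, G; split=> //.
- by move=> v u /fE/eqP.
- by move=> w w0 wG; apply: fW.
Qed.

(** Once the saturated vertices are finite in number, an embedding is tried twice in colour [true],
    with the two halves of the [true] neighbourhood of [m] as sources of hosts. The obstructions to
    both attempts supply hosts for colour [false]. *)
Theorem rich_root_spans : spans par c.
Proof.
pose sat b q := 0 < q /\ exists s : seq nat, forall x, x \notin s -> c q x = b.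
have [/rich_root_spans_saturated//|/ninfS[s1 Hs1]] := pselect (infS (sat true)).
have [/rich_root_spans_saturated//|/ninfS[s2 Hs2]] := pselect (infS (sat false)).
pose Z z := 0 < z /\ z \notin s1 ++ s2.
(* Outside the finitely many saturated vertices, all neighbourhoods of both colours are infinite,
   even within Z. *)
have Znbr b z : Z z -> infS (fun n => Z n /\ c z n = b).
  move=> [z0 zs]; apply: contrapT => /ninfS[u Hu].
  have : sat (~~ b) z.
    split=> //; exists (0 :: (s1 ++ s2) ++ u) => x.
    rewrite inE mem_cat !negb_or => /and3P[x0 xs xu].
    have [cb|] := eqVneq (c z x) b; last by case: (c z x) (b) => -[].
    by case/negP: xu; apply: Hu; split=> //; split; rewrite ?lt0n.
  move: zs; rewrite mem_cat negb_or => /andP[zs1 zs2].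
  by case: (b) => [/Hs2|/Hs1]; rewrite ?(negPf zs1) ?(negPf zs2).
have [m Zm] : exists m, Z m.
  exists (\max_(i <- s1 ++ s2) i).+1; split=> //.
  by apply/negP => /mem_bigmax; rewrite ltnn.
(* With hosts P among the [b]-neighbours of [m], only the numbers joined to [m] in the other colour
   remain to be put into fibres; [sx] lists those given up. *)
have attempt b (P : nat -> Prop) (sx : seq nat) :
    (forall p, P p -> [/\ Z p, p <> m & c m p = b]) ->
    (forall z, Z z -> infS (fun n => [/\ Z n, ~ P n & c z n = b])) ->
    (forall F : seq nat, exists G : seq nat, forall a,
       [/\ Z a, a <> m, c m a = ~~ b & a \notin sx] -> a \notin G ->
       exists p, [/\ P p, p \notin F & c p a == b]) -> spans par c.
  move=> HP HZ /finite_fibers[Fib [HFib [G HG]]].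
  have [|||||||f [f_inj f0 fE fW]] := @rich_root_embedding (fun x y => c x y == b) Z P
      (fun w => Z w /\ w \notin sx ++ G) Fib m.
  - by move=> z [].
  - by [].
  - by move=> /HP[].
  - by move=> z /HZ iz; apply: infS_sub iz _ => n [? ? /eqP].
  - by move=> p /HP[? _ /eqP].
  - move=> p a Pp /HFib[[[a0 _] _ ca _] Epa]; split=> // /HP[_ _].
    by rewrite ca; case: (b).
  - move=> w [Zw]; rewrite mem_cat negb_or => /andP[wsx wG].
    have [->|/eqP wm] := eqVneq w m; [by left|right].
    have [cw|cw] := eqVneq (c m w) b; first by left.
    right; apply: HG wG; split=> //.
    by case: (c m w) (b) cw => -[].
  exists b, f, ((s1 ++ s2) ++ sx ++ G); split=> //.
  - by move=> v u /fE/eqP.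
  - move=> w w0; rewrite mem_cat negb_or => /andP[ws wG].
    by apply: fW.
(* The splitting leaves every [z] infinitely many [true] neighbours in either half, so default
   positions remain whichever half supplies the hosts. *)
have [P0 HP0] := split_family (fun z n => Z n /\ c z n = true).
pose C (P : nat -> Prop) (F : seq nat) a := [/\ Z a, a <> m & c m a = false] /\
  forall p, P p -> p \notin F -> c p a = false.
have red (P : nat -> Prop) : (forall p, P p -> [/\ Z p, p <> m & c m p = true]) ->
    (forall z, Z z -> infS (fun n => [/\ Z n, ~ P n & c z n = true])) ->
    spans par c \/ exists F, infS (C P F).
  move=> HP HZ; apply: contrapT => /not_orP[nsp /forallNP HF]; apply: nsp.
  apply: (attempt true P [::] HP HZ) => F.
  have /ninfS[G HG] := HF F; exists G => a [Za am ca _] aG; apply: contrapT => nex.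
  suff : a \in G by rewrite (negPf aG).
  apply: HG; split; first by split.
  move=> p Pp pF; apply/negbTE/negP => cp; apply: nex.
  by exists p; split=> //; apply/eqP.
pose N n := [/\ Z n, n <> m & c m n = true].
have [||//|[F1 iC1]] := red (fun n => N n /\ P0 n).
- by move=> p [].
- move=> z Zz; have [_ iz] := HP0 z (Znbr true z Zz); apply: infS_sub iz _ => n [[Zn cn] nP].
  by split=> // -[].
have [||//|[F2 iC2]] := red (fun n => N n /\ ~ P0 n).
- by move=> p [].
- move=> z Zz; have [iz _] := HP0 z (Znbr true z Zz); apply: infS_sub iz _ => n [[Zn cn] nP].
  by split=> // -[].
(* All of C1 is joined by [false] to one half of the [true] neighbourhood of [m] up to F1, and all
   of C2 to the other half up to F2. Hence hosts taken from both reach every [true] neighbour of [m]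
   outside F1 and F2. *)
set C1 := C _ _ in iC1; set C2 := C _ _ in iC2.
have [P0' HP0'] := split_family (fun i n => match i with
  | 0 => C1 n | 1 => C2 n | z.+2 => Z n /\ c z n = false end).
have [iP1 _] := HP0' 0 iC1; have [iP2 _] := HP0' 1 iC2.
apply: (attempt false (fun n => (C1 n \/ C2 n) /\ P0' n) (F1 ++ F2)).
- by move=> p [[[]|[]]].
- move=> z /(Znbr false) iz; have [_ iz'] := HP0' z.+2 iz.
  by apply: infS_sub iz' _ => n [[Zn cn] nP]; split=> // -[].
- move=> F; exists [::] => a [Za am ca]; rewrite mem_cat negb_or => /andP[aF1 aF2] _.
  have [Pa|nPa] := pselect (P0 a).
    have [p [pF [[Cp Hp] Pp]]] := iP1 F; exists p; split=> //; first by split=> //; left.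
    by rewrite c_sym Hp.
  have [p [pF [[Cp Hp] Pp]]] := iP2 F; exists p; split=> //; first by split=> //; right.
  by rewrite c_sym Hp.
Qed.

End RichRoot.

(** * Embeddings along a cohesive set *)

Definition almost (K Q : nat -> Prop) : Prop :=
  exists s : seq nat, forall k, K k -> k \notin s -> Q k.

Lemma almost_and K Q Q' :
  almost K Q -> almost K Q' -> almost K (fun k => Q k /\ Q' k).
Proof.
move=> [s Hs] [u Hu]; exists (s ++ u) => k Kk.
by rewrite mem_cat negb_or => /andP[ks ku]; split; [apply: Hs | apply: Hu].
Qed.

Lemma almost_infS K Q : infS K -> almost K Q -> infS (fun k => K k /\ Q k).
Proof.
move=> iK [s Hs]; apply: (infS_but (s := s) iK) => k ks Kk.
by split=> //; apply: Hs.
Qed.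

Lemma almost_sub K Q Q' :
  almost K Q -> (forall k, K k -> Q k -> Q' k) -> almost K Q'.
Proof. by move=> [s Hs] QQ'; exists s => k Kk ks; apply: QQ' => //; apply: Hs. Qed.

Lemma not_almost K Q : ~ almost K Q -> infS (fun k => K k /\ ~ Q k).
Proof.
move=> nK; apply: contrapT => /ninfS[s Hs]; apply: nK; exists s => k Kk ks.
by apply: contrapT => nQ; move/negP: ks; apply; apply: Hs.
Qed.

Lemma almost_subset (K K' Q : nat -> Prop) :
  (forall k, K' k -> K k) -> almost K Q -> almost K' Q.
Proof. by move=> KK' [s Hs]; exists s => k /KK'; apply: Hs. Qed.

(** Restrict successively to an infinite set on which the vertex [i] sends one colour; a diagonal
    sequence [x] through these sets gives K0, to almost all of which every vertex sends one colour.
    Infinitely many members of K0 share theirs, and K keeps only those. *)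
Lemma cohesive_set (c : nat -> nat -> bool) :
  exists (b : bool) (K : nat -> Prop), [/\ infS K, forall k, K k -> 0 < k,
    forall n, almost K (fun k => c n k = b) \/ almost K (fun k => c n k = ~~ b) &
    forall n, K n -> almost K (fun k => c n k = b)].
Proof.
pose col i (A : nat -> Prop) := `[< infS (fun k => A k /\ c i k = true) >].
pose A := fix A (i k : nat) : Prop := if i is i'.+1 then A i' k /\ c i' k = col i' (A i') else 0 < k.
have iA i : infS (A i).
  elim: i => [|i IH]; first by apply: geq_infS => n; exists n.+1.
  rewrite /= /col; case: asboolP => // nt.
  have /infS_or[//|//] : infS (fun k => (A i k /\ c i k = true) \/ (A i k /\ c i k = false)).
  by apply: infS_sub IH _ => k Ak; case: (c i k); [left|right].
have A_le i j : i <= j -> forall k, A j k -> A i k.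
  elim: j => [|j IH]; first by rewrite leqn0 => /eqP->.
  rewrite leq_eqVlt => /orP[/eqP-> //|]; rewrite ltnS => /IH H k [/H].
  done.
have [x Hx] : exists x : nat -> nat, forall i, i <= x i /\ A i (x i).
  have H i : exists y, i <= y /\ A i y by have [y] := infS_ge i (iA i); exists y.
  by have [x Hx] := choice H; exists x.
pose K0 k := exists i, k = x i.
have iK0 : infS K0.
  by apply: geq_infS => n; exists (x n); [case: (Hx n) | exists n].
have K0_pos k : K0 k -> 0 < k by move=> [i ->]; case: (Hx i) => _ /(A_le 0 i (leq0n i)).
have K0_col n : almost K0 (fun k => c n k = col n (A n)).
  exists (map x (iota 0 n.+1)) => _ [i ->] xi.
  have ni : n < i.
    rewrite ltnNge; apply: contra xi => lin; apply: map_f.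
    by rewrite mem_iota add0n ltnS.
  by have [_ /(A_le n.+1 i ni)[]] := Hx i.
have K0_two b n : almost K0 (fun k => c n k = b) \/ almost K0 (fun k => c n k = ~~ b).
  by have := K0_col n; case: (col _ _) (b) => -[]; [left|right|right|left].
have /infS_or H : infS (fun k => (K0 k /\ almost K0 (fun l => c k l = true)) \/
                            (K0 k /\ almost K0 (fun l => c k l = false))).
  by apply: infS_sub iK0 _ => k Kk; case: (K0_two true k); [left|right].
suff main b : infS (fun k => K0 k /\ almost K0 (fun l => c k l = b)) ->
    exists K : nat -> Prop, [/\ infS K, forall k, K k -> 0 < k,
    forall n, almost K (fun k => c n k = b) \/ almost K (fun k => c n k = ~~ b) &
    forall n, K n -> almost K (fun k => c n k = b)].
  by case: H => /main[K HK]; [exists true, K | exists false, K].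
move=> iK; exists (fun k => K0 k /\ almost K0 (fun l => c k l = b)); split=> //.
- by move=> k [/K0_pos].
- by move=> n; case: (K0_two b n) => H'; [left|right]; apply: almost_subset H' => k [].
- by move=> n [_]; apply: almost_subset => k [].
Qed.

(** The host set and the fibres for embeddings without hosts, where the fibre condition of [valid]
    is vacuous. *)
Definition nowhere (_ : nat) : Prop := False.
Definition no_fiber (_ : nat) : seq nat := [::].

Section Cohesive.
Variables (c : nat -> nat -> bool) (b : bool) (K : nat -> Prop).
Hypothesis c_sym : forall x y, c x y = c y x.
Hypothesis K_inf : infS K.
Hypothesis K_pos : forall k, K k -> 0 < k.
Hypothesis K_two : forall n,
  almost K (fun k => c n k = b) \/ almost K (fun k => c n k = ~~ b).
Hypothesis K_R : forall n, K n -> almost K (fun k => c n k = b).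

Definition mostly_red n : Prop := 0 < n /\ almost K (fun k => c n k = b).
Definition mostly_blue n : Prop := 0 < n /\ ~ mostly_red n.
Local Notation R := mostly_red.
Local Notation B := mostly_blue.
Definition red x y := c x y == b.
Definition blue x y := c x y == ~~ b.

Lemma KR k : K k -> R k. Proof. by move=> Kk; split; [apply: K_pos|apply: K_R]. Qed.

Lemma redK n : R n -> almost K (red n).
Proof. by move=> [_ H]; apply: almost_sub H _ => k _ /eqP. Qed.

Lemma blueK n : B n -> almost K (blue n).
Proof.
move=> [n0 nR]; case: (K_two n) => [H|H]; first by case: nR.
by apply: almost_sub H _ => k _ /eqP.
Qed.

Lemma red_sym x y : red x y = red y x. Proof. by rewrite /red c_sym. Qed.
Lemma blue_sym x y : blue x y = blue y x. Proof. by rewrite /blue c_sym. Qed.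
Lemma redN x y : ~~ red x y = blue x y.
Proof. by rewrite /red /blue; case: (c x y) (b) => -[]. Qed.
Lemma RB n : 0 < n -> R n \/ B n.
Proof. by move=> n0; have [|] := pselect (R n); [left|right]. Qed.

Section Forest.
Variables (V : eqType) (idx : V -> nat) (par : V -> option V) (dep : V -> nat).
Variable cl : V -> bool.
Hypothesis idx_inj : injective idx.
Hypothesis dep_par : forall v u, par v = Some u -> dep v = (dep u).+1.
Hypothesis cl_par : forall v u, par v = Some u -> cl v = ~~ cl u.

Lemma spansI (E : nat -> nat -> bool) e (s : seq nat) (W : nat -> Prop) :
  (forall x y, E x y -> c x y = e) ->
  (forall w, 0 < w -> w \notin s -> W w) ->
  (exists f : V -> nat, [/\ injective f, forall v, 0 < f v,
    forall v u, par v = Some u -> E (f u) (f v) &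
    forall w, W w -> exists v, f v = w]) -> spans par c.
Proof.
move=> Ee sW [f [f_inj f0 fE fW]]; exists e, f, s; split=> //.
- by move=> v u /fE/Ee.
- by move=> w w0 ws; apply/fW/sW.
Qed.

(** An isolated vertex can sit at any number, so these vertices cover everything, while all others
    go to K, where red neighbours abound. *)
Lemma isolated_spans :
  infS (fun v => par v = None /\ nochild par v) -> spans par c.
Proof.
move=> iI; pose Z (_ : bool) := R; pose G (_ : bool) := K.
pose P (_ : nat) := False; pose Fib (_ : nat) : seq nat := [::].
apply: (@spansI red b [::] (fun w => 0 < w)) => //; first by move=> x y /eqP.
have GZ e n : G e n -> [/\ Z e n, ~ P n & 0 < n].
  by move=> Kn; split=> //; [apply: KR|apply: K_pos].
have G_nbr e m : Z (~~ e) m -> infS (fun n => G e n /\ red m n).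
  by move=> /redK; apply: almost_infS.
have G_inf e : infS (G e) by [].
apply: (back_and_forth (S0 := [::]) idx_inj dep_par cl_par GZ G_nbr G_inf (valid_nil _ _ _ _ _ Fib)).
move=> S w vS _ w0 wS; have [v [vS' [pv nv]]] := iI (unzip1 S).
apply: (place (v := v) vS) => //; last by right.
by split=> //; exists None; rewrite // /anchored pv.
Qed.

(** Hosts are vertices of R that are red to almost all of B, so their fibres exhaust almost all of
    B. Each position in R, host or not, is given to a vertex far from the current domain, through a
    common red neighbour in K. K is split so that default positions avoid the hosts. *)
Lemma far_rich_spans :
  (forall (D : seq V) l, exists x, far par 2 D x /\ rich par l x) ->
  infS (fun r => R r /\ almost B (red r)) -> spans par c.
Proof.
set Q := (X in infS X) => nd iQ.
have [A HA] := split_family (fun i => if i is 0 then Q else K).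
have [iQA _] := HA 0 iQ; have [_ iKA] := HA 1 K_inf.
pose P q := Q q /\ A q.
pose Z (_ : bool) := R; pose G (_ : bool) n := K n /\ ~ A n.
have [|Fib [HFib [G0 HG0]]] := @finite_fibers red B P.
  move=> F; have [p [pF Pp]] := iQA F; have [[_ [s Hs]] _] := Pp.
  by exists s => a Ba aG; exists p; split=> //; apply: Hs.
have Fib_ok p a : P p -> a \in Fib p -> [/\ red p a, ~ P a & 0 < a].
  by move=> Pp /HFib[[a0 nR] pa]; split=> // -[[]].
have GZ e n : G e n -> [/\ Z e n, ~ P n & 0 < n].
  by move=> [Kn nAn]; split; [apply: KR|case|apply: K_pos].
have G_nbr e m : Z (~~ e) m -> infS (fun n => G e n /\ red m n).
  move=> /redK[s Hs]; apply: (infS_but (s := s) iKA) => n ns [Kn nAn].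
  by split=> //; apply: Hs.
have G_inf e : infS (G e) by [].
apply: (@spansI red b G0 (fun w => 0 < w /\ w \notin G0)) => //; first by move=> x y /eqP.
apply: (back_and_forth (S0 := [::]) idx_inj dep_par cl_par GZ G_nbr G_inf (valid_nil _ _ _ _ _ Fib)).
move=> S w vS _ [w0 wG] wS.
have ex l r : R r -> r \notin unzip2 S -> exists x S',
    [/\ rich par l x, {subset S <= S'}, valid par cl red Z P Fib S' & ready par red S' x r].
  move=> Rr rS; have [x [fx rx]] := nd (unzip1 S) l; exists x.
  have [|S' [? ? ? _]] := place_far dep_par cl_par GZ G_nbr G_inf vS fx rS; last by exists S'.
  move=> a F aok.
  have [s Hs] : almost K (fun n => red r n /\ ea red a n).
    apply: almost_and (redK Rr) _; case: a aok => [m|] /= aok; first exact: redK aok.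
    by exists [::].
  have [n [+ [Kn nAn]]] := iKA (r :: s ++ F).
  rewrite inE mem_cat !negb_or => /and3P[nr ns nF].
  have [rn an] := Hs n Kn ns; exists n; split=> //=; last by rewrite red_sym.
  by split; [apply: KR|case|apply: K_pos].
have cover_P p : P p -> p \notin unzip2 S -> exists S',
    [/\ {subset S <= S'}, valid par cl red Z P Fib S', p \in unzip2 S' &
        {subset Fib p <= unzip2 S'}].
  move=> Pp pS; have [[Rp _] _] := Pp.
  have [x [S1 [rx SS1 vS1 xp]]] := ex (size (Fib p)) p Rp pS.
  have [S2 [S12 ? ? ?]] := host dep_par Fib_ok vS1 xp (proj1 Rp) Rp rx Pp.
  by exists S2; split=> // y /SS1/S12.
have [Pw|nPw] := pselect (P w).
  by have [S' [? ? ? _]] := cover_P w Pw wS; exists S'.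
have [Rw|Bw] := RB w0.
  have [x [S1 [_ SS1 vS1 xw]]] := ex 0 w Rw wS.
  have [|S2 [S12 ? ?]] := place vS1 xw w0 _ nPw; first by left.
  by exists S2; split=> // y /SS1/S12.
have [p Pp wp] := HG0 w Bw wG.
have [pS|pS] := boolP (p \in unzip2 S).
  by case: vS => _ /(_ p w pS Pp wp); rewrite (negPf wS).
by have [S' [? ? _ H]] := cover_P p Pp pS; exists S'; split=> //; apply: H.
Qed.


Section NoPending.
Variable E : nat -> nat -> bool.
Variables Z G : bool -> nat -> Prop.
Local Notation valid := (valid par cl E Z nowhere no_fiber).
Hypothesis GZ : forall e n, G e n -> [/\ Z e n, ~ nowhere n & 0 < n].
Hypothesis G_nbr : forall e m, Z (~~ e) m -> infS (fun n => G e n /\ E m n).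
Hypothesis G_inf : forall e, infS (G e).

Lemma spans_cover e (s : seq nat) S0 : (forall x y, E x y -> c x y = e) ->
  valid S0 ->
  (forall S w, valid S -> {subset S0 <= S} -> 0 < w -> w \notin s ->
     w \notin unzip2 S -> exists S' v,
     [/\ {subset S <= S'}, valid S', ready par E S' v w &
         Z (cl v) w \/ nochild par v]) ->
  spans par c.
Proof.
move=> Ee vS0 H.
apply: (spansI (W := fun w => 0 < w /\ w \notin s) (s := s) Ee) => //.
apply: (back_and_forth idx_inj dep_par cl_par GZ G_nbr G_inf vS0).
move=> S w vS S0S [w0 ws] wS; have [S' [v [SS' vS' vw ok]]] := H S w vS S0S w0 ws wS.
have [//|S2 [S12 ? ?]] := place vS' vw w0 ok.
by exists S2; split=> // y /SS'/S12.
Qed.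

Lemma ready_child S t m x w : (t, m) \in S -> par x = Some t ->
  x \notin unzip1 S -> w \notin unzip2 S -> E m w -> ready par E S x w.
Proof.
move=> tm px xS wS Emw; split=> //; exists (Some m) => //.
by rewrite /anchored px; exists m.
Qed.

Lemma cover_child S t m w : valid S -> (t, m) \in S ->
  infS (fun x => par x = Some t) -> w \notin unzip2 S -> E m w ->
  Z (~~ cl t) w -> exists S' v,
     [/\ {subset S <= S'}, valid S', ready par E S' v w &
         Z (cl v) w \/ nochild par v].
Proof.
move=> vS tm it wS Emw Zw; have [x [xS px]] := it (unzip1 S).
exists S, x; split=> //; first exact: ready_child tm px xS wS Emw.
by left; rewrite (cl_par px).
Qed.

(** Infinitely many children of [t] have a descendant [j] levels below them; the chain through a new
    such child carries the walk from [m] to [w]. *)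
Lemma cover_descendant j S t m w : valid S -> (t, m) \in S ->
  infS (fun x => par x = Some t /\ exists v, anc par j v = Some x) ->
  w \notin unzip2 S -> (forall e, Z e w) ->
  (forall e F, walk E Z nowhere j e (Some m) w F) ->
  exists S' v,
     [/\ {subset S <= S'}, valid S', ready par E S' v w &
         Z (cl v) w \/ nochild par v].
Proof.
move=> vS tm it wS Zw Hw; have [x [xS [px [v vx]]]] := it (unzip1 S).
have ax : anchored par S x (Some m) by rewrite /anchored px; exists m.
have [S' [SS' vS' rv _]] := place_along dep_par cl_par vS vx xS ax wS (Hw _ _).
by exists S', v; split=> //; left.
Qed.

Lemma cover_far j S v w : valid S -> far par j.+1 (unzip1 S) v ->
  w \notin unzip2 S -> Z (cl v) w ->
  (forall a F, okA Z (iter j negb (cl v)) a ->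
     walk E Z nowhere j (iter j negb (cl v)) a w F) ->
  exists S' v,
     [/\ {subset S <= S'}, valid S', ready par E S' v w &
         Z (cl v) w \/ nochild par v].
Proof.
move=> vS fv wS Zw Hw.
have [S' [SS' vS' rv _]] := place_far dep_par cl_par GZ G_nbr G_inf vS fv wS Hw.
by exists S', v; split=> //; left.
Qed.

End NoPending.


(* Red embeddings with all vertices in R, except that leaves may be elsewhere *)
Definition ZR (_ : bool) := R.
Definition GK (_ : bool) := K.

Lemma GK_ZR e n : GK e n -> [/\ ZR e n, ~ nowhere n & 0 < n].
Proof. by move=> Kn; split=> //; [apply: KR|apply: K_pos]. Qed.

Lemma GK_nbr e m : ZR (~~ e) m -> infS (fun n => GK e n /\ red m n).
Proof. by move=> /redK; apply: almost_infS. Qed.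

Lemma GK_inf e : infS (GK e). Proof. by []. Qed.

(** Two vertices of R have infinitely many common red neighbours in K. *)
Lemma walk1_R e a w F : R w -> okA ZR e a -> walk red ZR nowhere 1 e a w F.
Proof.
move=> Rw aok.
have H : almost K (fun n => red w n /\ ea red a n).
  apply: almost_and (redK Rw) _; case: a aok => [m|] /= aok; first exact: redK aok.
  by exists [::].
have [n [+ [Kn [wn an]]]] := almost_infS K_inf H (w :: F).
rewrite inE negb_or => /andP[nw nF]; exists n; split=> //=; last by rewrite red_sym.
by split=> //; [apply: KR|apply: K_pos].
Qed.

(** With [t] at [q], the childless children of [t] cover almost all of B, and vertices far from the
    domain cover R. *)
Lemma star_spans t q : par t = None ->
  infS (fun x => par x = Some t /\ nochild par x) ->
  (forall D : seq V, exists v, far par 2 D v) ->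
  R q -> almost B (red q) -> spans par c.
Proof.
move=> pt it nd Rq [s Hs]; have q0 := proj1 Rq.
have vS0 : valid par cl red ZR nowhere no_fiber [:: (t, q)] by apply: valid_root.
apply: (spans_cover GK_ZR GK_nbr GK_inf (e := b) (s := s) _ vS0).
  by move=> x y /eqP.
move=> S w vS S0S w0 ws wS; have [Rw|Bw] := RB w0.
- have [v fv] := nd (unzip1 S).
  by apply: (cover_far GK_ZR GK_nbr GK_inf vS fv wS Rw) => a F; apply: walk1_R.
- have [x [xS [px nx]]] := it (unzip1 S); exists S, x; split=> //; last by right.
  by apply: ready_child px xS wS (Hs w Bw ws); apply: S0S; rewrite mem_head.
Qed.

(** * Blue embeddings with one class in B and the other in R *)

Section Bipartite.
Variable s : seq nat.
Hypothesis blue_B : forall r, R r -> r \notin s -> infS (fun n => B n /\ blue r n).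

Definition ZB (e : bool) n := if e then B n else R n /\ n \notin s.
Definition GB (e : bool) n := if e then B n else K n /\ n \notin s.

Lemma GB_ZB e n : GB e n -> [/\ ZB e n, ~ nowhere n & 0 < n].
Proof.
case: e => /=; first by move=> [n0 nR]; split.
by move=> [Kn ns]; split=> //; [split=> //; apply: KR|apply: K_pos].
Qed.

Lemma GB_nbr e m : ZB (~~ e) m -> infS (fun n => GB e n /\ blue m n).
Proof.
case: e => /= [[Rm ms]|Bm]; first exact: blue_B.
apply: (infS_but (s := s) (almost_infS K_inf (blueK Bm))) => n ns [Kn mn].
by split.
Qed.

Lemma GB_inf e : infS (GB e).
Proof.
case: e => /=; last by apply: (infS_but (s := s) K_inf) => n ns Kn; split.
have [k [ks Kk]] := K_inf s.
by apply: infS_sub (blue_B (KR Kk) ks) _ => n [].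
Qed.

Lemma walk1_B a w F : B w -> okA ZB false a -> walk blue ZB nowhere 1 false a w F.
Proof.
move=> Bw aok.
have H : almost K (fun n => blue w n /\ ea blue a n).
  apply: almost_and (blueK Bw) _; case: a aok => [m|] /= aok; first exact: blueK aok.
  by exists [::].
have [n [+ [Kn [wn an]]]] := almost_infS K_inf H (w :: s ++ F).
rewrite inE mem_cat !negb_or => /and3P[nw ns nF]; exists n; split=> //=.
  by split=> //; [split=> //; apply: KR|apply: K_pos].
by rewrite blue_sym.
Qed.

(** A vertex of R need not have blue neighbours in K. So a blue neighbour [y] of [w] in B is chosen
    first, and then a common blue neighbour of [y] and the anchor in K. *)
Lemma walk2_R a w F : R w -> w \notin s -> okA ZB false a ->
  walk blue ZB nowhere 2 false a w F.
Proof.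
move=> Rw ws aok; have [y [+ [By wy]]] := blue_B Rw ws (w :: F).
rewrite inE negb_or => /andP[yw yF].
have H : almost K (fun n => blue y n /\ ea blue a n).
  apply: almost_and (blueK By) _; case: a aok => [m|] /= aok; first exact: blueK aok.
  by exists [::].
have [n [+ [Kn [yn an]]]] := almost_infS K_inf H (w :: y :: s ++ F).
rewrite !inE mem_cat !negb_or => /and4P[nw ny ns nF]; exists n; split=> //=.
  by split=> //; [split=> //; apply: KR|apply: K_pos].
exists y; split=> //=.
- by rewrite inE negb_or eq_sym ny.
- by split=> //; case: By.
- by rewrite blue_sym.
- by rewrite blue_sym.
Qed.

(** A far vertex [x] of class [true] takes a position in B; a child of such an [x] is one level
    farther from the domain and takes a position in R by [walk2_R]. *)
Lemma bipartite_spans :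
  (forall D : seq V, exists x, [/\ cl x = true, far par 2 D x &
     exists y, par y = Some x]) -> spans par c.
Proof.
move=> nd.
have vS0 : valid par cl blue ZB nowhere no_fiber [::] by apply: valid_nil.
apply: (spans_cover GB_ZB GB_nbr GB_inf (e := ~~ b) (s := s) _ vS0).
  by move=> x y /eqP.
move=> S w vS _ w0 ws wS; have [x [clx fx [y py]]] := nd (unzip1 S).
have [Rw|Bw] := RB w0.
- have fy : far par 3 (unzip1 S) y.
    split; last by rewrite py.
    case: fx => xS _; apply: contra xS => yS.
    exact: (raw_dom_par (proj1 vS) yS py).
  have cly : cl y = false by rewrite (cl_par py) clx.
  apply: (cover_far GB_ZB GB_nbr GB_inf vS fy wS); first by rewrite cly.
  by move=> a F; rewrite /= cly; apply: walk2_R.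
- apply: (cover_far GB_ZB GB_nbr GB_inf vS fx wS); first by rewrite clx.
  by move=> a F; rewrite /= clx; apply: walk1_B.
Qed.

(** With [t] at [r0], its children cover R outside [s], and far vertices of the class of [t] cover
    B. *)
Lemma bipartite_star_spans t r0 : par t = None -> cl t = true ->
  infS (fun x => par x = Some t) ->
  (forall D : seq V, exists x, cl x = true /\ far par 2 D x) ->
  B r0 -> (forall r, R r -> r \notin s -> blue r0 r) -> spans par c.
Proof.
move=> pt clt it nd Br0 Hr0.
have vS0 : valid par cl blue ZB nowhere no_fiber [:: (t, r0)].
  by apply: valid_root; rewrite ?clt //; case: Br0.
apply: (spans_cover GB_ZB GB_nbr GB_inf (e := ~~ b) (s := s) _ vS0).
  by move=> x y /eqP.
move=> S w vS S0S w0 ws wS; have [Rw|Bw] := RB w0.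
- apply: (cover_child vS _ it wS (Hr0 w Rw ws)); last by rewrite clt.
  by apply: S0S; rewrite mem_head.
- have [x [clx fx]] := nd (unzip1 S).
  apply: (cover_far GB_ZB GB_nbr GB_inf vS fx wS); first by rewrite clx.
  by move=> a F; rewrite /= clx; apply: walk1_B.
Qed.

End Bipartite.

Definition ZT (_ : bool) (n : nat) := 0 < n.

Lemma sub_ZT (Z : bool -> nat -> Prop) E S :
  (forall e n, Z e n -> 0 < n) ->
  valid par cl E Z nowhere no_fiber S -> valid par cl E ZT nowhere no_fiber S.
Proof. by move=> Z0; apply: valid_sub_Z. Qed.

(** * Red embeddings when every vertex of B has infinitely many red neighbours in R *)

Section RedCovers.
Hypothesis red_R : forall w, B w -> infS (fun n => R n /\ red w n).
Definition GR (_ : bool) := R.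

Lemma red_R_all w : 0 < w -> infS (fun n => R n /\ red w n).
Proof.
move=> /RB[Rw|]; last exact: red_R.
by apply: infS_sub (almost_infS K_inf (redK Rw)) _ => n [/KR].
Qed.

Lemma GR_ZT e n : GR e n -> [/\ ZT e n, ~ nowhere n & 0 < n].
Proof. by move=> [n0 _]; split. Qed.

Lemma GR_nbr e m : ZT (~~ e) m -> infS (fun n => GR e n /\ red m n).
Proof. exact: red_R_all. Qed.

Lemma GR_inf e : infS (GR e).
Proof. by apply: infS_sub K_inf _ => n /KR. Qed.

Lemma red_two m n (F : seq nat) : R m -> R n -> exists k, [/\ k \notin F, K k, red m k & red k n].
Proof.
move=> /redK Rm /redK Rn.
have [k [kF [Kk [mk nk]]]] := almost_infS K_inf (almost_and Rm Rn) F.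
by exists k; split=> //; rewrite red_sym.
Qed.

(** Choose a red neighbour [n] of [w] in R, then a common red neighbour of [m] and [n] in K. *)
Lemma walk2_T e m w F : R m -> 0 < w -> walk red ZT nowhere 2 e (Some m) w F.
Proof.
move=> Rm w0; have [n [+ [Rn wn]]] := red_R_all w0 (w :: F).
rewrite inE negb_or => /andP[nw nF].
have [k [+ Kk mk kn]] := red_two (w :: n :: F) Rm Rn.
rewrite !inE !negb_or => /and3P[kw kn' kF]; exists k; split=> //.
  by split=> //; apply: K_pos.
exists n; split=> //=; last by rewrite red_sym.
- by rewrite inE negb_or eq_sym kn'.
- by case: Rn => n0 _; split.
Qed.

(** Three new positions precede [w]: the first moves from an arbitrary anchor into R, and [walk2_T]
    supplies the other two. *)
Lemma far4_spans : (forall D : seq V, exists v, far par 4 D v) -> spans par c.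
Proof.
move=> nd.
have vS0 : valid par cl red ZT nowhere no_fiber [::] by apply: valid_nil.
apply: (spans_cover GR_ZT GR_nbr GR_inf (e := b) (s := [::]) _ vS0).
  by move=> x y /eqP.
move=> S w vS _ w0 _ wS; have [v fv] := nd (unzip1 S).
apply: (cover_far GR_ZT GR_nbr GR_inf vS fv wS w0) => a F aok.
have [n [nwF [Rn an]]] : exists n, n \notin w :: F /\ R n /\ ea red a n.
  case: a aok => [m|] /= aok; first exact: red_R_all aok (w :: F).
  by have [k [? ?]] := K_inf (w :: F); exists k; split=> //; split=> //; apply: KR.
move: nwF; rewrite inE negb_or => /andP[nw nF].
exists n; split=> //; first by split=> //; case: Rn.
exact: walk2_T.
Qed.

(** Default positions lie in R, so [t] sits in R and [walk2_T] reaches any [w] with a vertex three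
    levels below [t]. *)
Lemma deep_star_spans t :
  infS (fun x => par x = Some t /\ exists v, anc par 2 v = Some x) -> spans par c.
Proof.
move=> it.
have [S0 [_ vS0 tS0 newS0]] :=
  extend_default dep_par cl_par GR_ZT GR_nbr GR_inf t [::] (valid_nil _ _ _ _ _ no_fiber).
have [m tm] := domP tS0.
have Rm : R m by have [//|[]] := newS0 _ _ tm.
apply: (spans_cover GR_ZT GR_nbr GR_inf (e := b) (s := [::]) _ vS0).
  by move=> x y /eqP.
move=> S w vS S0S w0 _ wS.
by apply: (cover_descendant vS (S0S _ tm) it wS) => // e F; apply: walk2_T.
Qed.

(** A number is covered by a child of an embedded vertex of infinite degree, or by a grandchild of
    [t] through a common red neighbour with [m]. For numbers in R the latter always works, inside
    K. *)
Lemma two_star_spans_red (s : seq nat) S0 t m :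
  valid par cl red ZT nowhere no_fiber S0 -> (t, m) \in S0 -> R m ->
  infS (fun x => par x = Some t /\ exists v, anc par 1 v = Some x) ->
  (forall w, B w -> w \notin s ->
     (exists t' m', [/\ (t', m') \in S0, infS (fun x => par x = Some t') & red m' w]) \/
     infS (fun n => R n /\ red m n /\ red w n)) -> spans par c.
Proof.
move=> vS0 tm Rm it Hs.
apply: (spans_cover GR_ZT GR_nbr GR_inf (e := b) (s := s) _ vS0).
  by move=> x y /eqP.
move=> S w vS S0S w0 ws wS.
have two : infS (fun n => R n /\ red m n /\ red w n) -> exists S' v,
     [/\ {subset S <= S'}, valid par cl red ZT nowhere no_fiber S',
         ready par red S' v w & ZT (cl v) w \/ nochild par v].
  move=> iN; apply: (cover_descendant vS (S0S _ tm) it wS) => // e F.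
  have [n [+ [Rn [mn wn]]]] := iN (w :: F).
  rewrite inE negb_or => /andP[nw nF]; exists n; split=> //=; last by rewrite red_sym.
  by split=> //; case: Rn.
have [Rw|Bw] := RB w0.
  apply: two; apply: infS_sub (almost_infS K_inf (almost_and (redK Rm) (redK Rw))) _.
  by move=> n [/KR].
have [[t' [m' [tm' it' mw]]]|] := Hs w Bw ws; last exact: two.
exact: cover_child vS (S0S _ tm') it' wS mw w0.
Qed.

End RedCovers.

(** * Two vertices of infinite degree when both mixed neighbourhoods are infinite *)

Section TwoStars.
Hypothesis red_R : forall w, B w -> infS (fun n => R n /\ red w n).
Hypothesis blue_B : forall r, R r -> infS (fun n => B n /\ blue r n).

Lemma blue_all w : 0 < w -> infS (fun n => 0 < n /\ blue w n).
Proof.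
move=> /RB[Rw|Bw].
- by apply: infS_sub (blue_B Rw) _ => n [[]].
- by apply: infS_sub (almost_infS K_inf (blueK Bw)) _ => n [/K_pos].
Qed.

Lemma ZT_ZT e n : ZT e n -> [/\ ZT e n, ~ nowhere n & 0 < n].
Proof. by move=> n0; split. Qed.

Lemma ZT_nbr e m : ZT (~~ e) m -> infS (fun n => ZT e n /\ blue m n).
Proof. exact: blue_all. Qed.

Lemma ZT_inf e : infS (ZT e).
Proof. by apply: infS_sub K_inf _ => n /K_pos. Qed.

(** Children of [t] or [t'] cover R; grandchildren of [t] cover B through common blue neighbours in
    K. *)
Lemma two_star_spans_blue (s : seq nat) S0 t m t' m' :
  valid par cl blue ZT nowhere no_fiber S0 -> (t, m) \in S0 -> (t', m') \in S0 -> B m ->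
  infS (fun x => par x = Some t /\ exists v, anc par 1 v = Some x) ->
  infS (fun x => par x = Some t') ->
  (forall r, R r -> r \notin s -> blue m r \/ blue m' r) -> spans par c.
Proof.
move=> vS0 tm tm' Bm it it' Hs.
apply: (spans_cover ZT_ZT ZT_nbr ZT_inf (e := ~~ b) (s := s) _ vS0).
  by move=> x y /eqP.
move=> S w vS S0S w0 ws wS; have [Rw|Bw] := RB w0.
  have [mw|mw] := Hs w Rw ws.
  - apply: cover_child vS (S0S _ tm) _ wS mw w0.
    by apply: infS_sub it _ => x [].
  - exact: cover_child vS (S0S _ tm') it' wS mw w0.
apply: (cover_descendant vS (S0S _ tm) it wS) => // e F.
have [n [+ [Kn [mn wn]]]] := almost_infS K_inf (almost_and (blueK Bm) (blueK Bw)) (w :: F).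
rewrite inE negb_or => /andP[nw nF]; exists n; split=> //=; last by rewrite blue_sym.
by split=> //; apply: K_pos.
Qed.

(** If red embeddings with [t1] at [r] in R fail, infinitely many [w] in B have only finitely many
    common red neighbours with [r] in R. A blue embedding with [t1] at such a [w] and [t2] at [r]
    then covers almost all of R. What remains is to realise the path between [t1] and [t2] in
    blue. *)
Lemma two_stars_span t1 t2 : par t1 = None -> cl t1 = true -> t2 != t1 ->
  infS (fun x => par x = Some t1 /\ exists v, anc par 1 v = Some x) ->
  infS (fun x => par x = Some t2) -> spans par c.
Proof.
move=> pt1 clt1 t21 it1 it2; apply: contrapT => nspan.
have it1' : infS (fun x => par x = Some t1) by apply: infS_sub it1 _ => x [].
pose com r w := infS (fun n => R n /\ red r n /\ red w n).
have fails_red S0 r : valid par cl red ZT nowhere no_fiber S0 -> (t1, r) \in S0 -> R r ->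
    infS (fun w => [/\ B w, ~ com r w & forall t' m', (t', m') \in S0 ->
      infS (fun x => par x = Some t') -> blue m' w]).
  move=> vS0 tr Rr; apply: contrapT => /ninfS[s Hs]; apply: nspan.
  apply: (two_star_spans_red red_R vS0 tr Rr it1 (s := s)) => w Bw ws.
  have [|ncom] := pselect (com r w); [by right|left].
  apply: contrapT => nex; move/negP: ws; apply; apply: Hs; split=> // t' m' tm it'.
  by rewrite -redN; apply/negP => mw; apply: nex; exists t', m'.
(* If [w] and [r] have finitely many common red neighbours in R, almost every vertex of R is blue to
   one of them. *)
have fails_blue S0 w r : valid par cl blue ZT nowhere no_fiber S0 ->
    (t1, w) \in S0 -> (t2, r) \in S0 -> B w -> ~ com r w -> False.
  move=> vS0 tw tr Bw /ninfS[s Hs]; apply: nspan.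
  apply: (two_star_spans_blue vS0 tw tr Bw it1 it2 (s := s)) => n Rn ns.
  have [wn|] := boolP (red w n); last by rewrite redN; left.
  have [rn|] := boolP (red r n); last by rewrite redN; right.
  by move/negP: ns; case; apply: Hs.
have BnR w r : B w -> R r -> w != r.
  by move=> [_ nRw] Rr; apply/eqP => wr; apply: nRw; rewrite wr.
have root1 E w : 0 < w -> valid par cl E ZT nowhere no_fiber [:: (t1, w)].
  by move=> w0; apply: valid_root.
have [k [_ Kk]] := K_inf [::]; have Rk := KR Kk; have k0 := K_pos Kk.
have [w [_ [Bw ncom /(_ t1 k)]]] := fails_red _ _ (root1 red k k0) (mem_head _ _) Rk [::].
rewrite mem_head => /(_ isT it1') kw.
have w0 := proj1 Bw; have wk := BnR _ _ Bw Rk.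
case pt2 : (par t2) => [u|]; last first.
  apply: (fails_blue [:: (t2, k); (t1, w)] w k) => //; rewrite ?inE ?eqxx ?orbT //.
  apply: (valid_cons (root1 blue w w0)) => //; last by left.
  split; [by rewrite /= mem_seq1|by rewrite /= mem_seq1 eq_sym|].
  by exists None => //; rewrite /anchored pt2.
have [ut1|ut1] := eqVneq u t1.
  apply: (fails_blue [:: (t2, k); (t1, w)] w k) => //; rewrite ?inE ?eqxx ?orbT //.
  apply: (valid_cons (root1 blue w w0)) => //; last by left.
  split; [by rewrite /= mem_seq1|by rewrite /= mem_seq1 eq_sym|].
  exists (Some w); last by rewrite /= blue_sym.
  by rewrite /anchored pt2 ut1; exists w; rewrite mem_head.
(* If t1 and t2 have the same class, the embedded path between them uses the
   blue edge r1 k inside R, all its other edges joining R and B. *)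
have [r1 [Rr1 r1k kr1]] : exists r1, [/\ R r1, r1 != k & blue k r1].
  move/ninfS: ncom => [s Hs].
  have [n [+ [Rn wn]]] := red_R Bw (k :: s); rewrite inE negb_or => /andP[nk ns].
  exists n; split=> //; rewrite -redN; apply/negP => kn.
  by move/negP: ns; apply; apply: Hs.
have r10 := proj1 Rr1.
(* A red embedding with [t1] at [k] and [t2] at [r1] has to fail as well, and its failure yields a
   vertex of B that is blue to [r1] and has few common red neighbours with [k]. *)
have [S1 [S1t1 vS1 S1t2]] : exists S1, [/\ (t1, k) \in S1,
    valid par cl red ZT nowhere no_fiber S1 & (t2, r1) \in S1].
  have vS0 : valid par cl red ZR nowhere no_fiber [:: (t1, k)] by apply: valid_root.
  have fu : far par 2 (unzip1 [:: (t1, k)]) t2.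
    by rewrite /= pt2 !mem_seq1 t21 ut1; case: (par u).
  have rS0 : r1 \notin unzip2 [:: (t1, k)] by rewrite /= mem_seq1.
  have [|S1 [SS1 vS1 rS1 _]] :=
    place_far dep_par cl_par GK_ZR GK_nbr GK_inf vS0 fu rS0.
    by move=> a F; apply: walk1_R.
  exists ((t2, r1) :: S1); rewrite !inE eqxx SS1 ?mem_head ?orbT; split=> //.
  apply: (@sub_ZT ZR); first by move=> e n [].
  by apply: (valid_cons vS1 rS1) => //; left.
have [w' [_ [Bw' ncom' Hw']]] := fails_red _ _ vS1 S1t1 Rk [::].
have r1w' : blue r1 w' by apply: Hw' S1t2 it2.
have {Hw'} w'0 := proj1 Bw'; have w'k := BnR _ _ Bw' Rk; have w'r1 := BnR _ _ Bw' Rr1.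
have ZB_pos e n : ZB [:: k] e n -> 0 < n by case: e => [[]|[[]]].
have blue_B' r : R r -> r \notin [:: k] -> infS (fun n => B n /\ blue r n).
  by move=> Rr _; apply: blue_B.
have vB : valid par cl blue (ZB [:: k]) nowhere no_fiber [:: (t1, w')].
  by apply: valid_root => //; rewrite clt1.
(* For different classes, a blue path alternating between B and R leads from [t1] at [w'] to [t2] at
   [k]. *)
case clt2 : (cl t2); last first.
  have blue_B0 r : R r -> r \notin [::] -> infS (fun n => B n /\ blue r n).
    by move=> Rr _; apply: blue_B.
  have vB0 : valid par cl blue (ZB [::]) nowhere no_fiber [:: (t1, w')].
    by apply: valid_root => //; rewrite clt1.
  have f3 : far par 3 (unzip1 [:: (t1, w')]) t2.
    rewrite /= pt2 !mem_seq1 t21 ut1; split=> //; split=> //.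
    case pu : (par u) => [x|//]; rewrite mem_seq1; split; last by case: (par x).
    apply/eqP => xt1; move: clt2.
    by rewrite (cl_par pt2) (cl_par pu) xt1 clt1.
  have kS0 : k \notin unzip2 [:: (t1, w')] by rewrite /= mem_seq1 eq_sym.
  have [|S2 [SS2 vS2 rS2 _]] :=
    place_far dep_par cl_par (@GB_ZB [::]) (GB_nbr blue_B0) (GB_inf blue_B0) vB0 f3 kS0.
    by move=> a F; rewrite /= clt2; apply: walk2_R.
  apply: (fails_blue ((t2, k) :: S2) w' k) => //; rewrite ?mem_head //; last first.
    by rewrite inE SS2 ?mem_head ?orbT.
  apply: (valid_cons _ rS2) => //; last by left.
  by apply: sub_ZT vS2 => -[] n; [case|case=> -[]].
(* For equal classes, the parent [u] of [t2] goes to [r1] and [t2] to [k]; therefore [k] must stay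
   unoccupied until then. *)
suff [S2 [vS2 St1 Su kS2 tS2]] : exists S2, [/\
    valid par cl blue ZT nowhere no_fiber S2, (t1, w') \in S2, (u, r1) \in S2,
    k \notin unzip2 S2 & t2 \notin unzip1 S2].
  apply: (fails_blue ((t2, k) :: S2) w' k) => //; rewrite ?mem_head ?inE ?St1 ?orbT //.
  apply: (valid_cons vS2) => //; last by left.
  split=> //; exists (Some r1); last by rewrite /= blue_sym.
  by rewrite /anchored pt2; exists r1.
have [pu|pu] := pselect (par u = Some t1).
  exists [:: (u, r1); (t1, w')]; rewrite !inE !eqxx !orbT; split=> //.
  - apply: (valid_cons (root1 blue w' w'0)) => //; last by left.
    split; [by rewrite /= mem_seq1|by rewrite /= mem_seq1 eq_sym|].
    exists (Some w'); last by rewrite /= blue_sym.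
    by rewrite /anchored pu; exists w'; rewrite mem_head.
  - by rewrite negb_or eq_sym r1k eq_sym w'k.
  - rewrite negb_or t21 andbT; apply/eqP => /= t2u.
    by rewrite -t2u in pt2; case: (par_irrefl dep_par pt2).
have clu : cl u = false by move: clt2; rewrite (cl_par pt2); case: (cl u).
have f3 : far par 3 (unzip1 [:: (t1, w')]) u.
  rewrite /= !mem_seq1 ut1; split=> //; case pu' : (par u) => [x|//].
  rewrite mem_seq1; split; first by apply/eqP => xt1; apply: pu; rewrite pu' xt1.
  case px : (par x) => [y|//]; rewrite mem_seq1; split; last by case: (par y).
  apply/eqP => yt1.
  by move: clu; rewrite (cl_par pu') (cl_par px) yt1 clt1.
have r1S0 : r1 \notin unzip2 [:: (t1, w')] by rewrite /= mem_seq1 eq_sym.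
have [|S2 [SS2 vS2 rS2 newS2]] :=
  place_far dep_par cl_par (@GB_ZB [:: k]) (GB_nbr blue_B') (GB_inf blue_B') vB f3 r1S0.
  by move=> a F; rewrite /= clu; apply: (walk2_R blue_B') => //; rewrite mem_seq1.
have vS3 : valid par cl blue (ZB [:: k]) nowhere no_fiber ((u, r1) :: S2).
  by apply: (valid_cons vS2 rS2) => //; left; rewrite clu /= mem_seq1.
exists ((u, r1) :: S2); rewrite inE SS2 ?mem_head ?orbT; split=> //.
- exact: sub_ZT vS3.
- rewrite /= inE negb_or eq_sym r1k; apply/negP => /ranP[y /newS2[|]].
    by rewrite mem_seq1 => /eqP[_ kw']; rewrite kw' eqxx in w'k.
  by case: (cl y) => [[_ nRk]|[_]]; [case: nRk | rewrite mem_seq1 eqxx].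
- rewrite /= inE negb_or; apply/andP; split.
    by apply/eqP => /= t2u; rewrite -t2u in pt2; case: (par_irrefl dep_par pt2).
  case: rS2 => uS2 _ _; apply: contra uS2 => t2S.
  exact: (raw_dom_par (proj1 vS2) t2S pt2).
Qed.

End TwoStars.

End Forest.
End Cohesive.

(** * Rooting a forest *)

Section Graph.
Variables (V : choiceType) (adj : V -> V -> Prop) (idx : V -> nat).
Hypothesis idx_inj : injective idx.
Hypothesis adj_sym : forall u v, adj u v -> adj v u.
Hypothesis adj_irr : forall v, ~ adj v v.
Hypothesis acyclic : forest adj.

Let e : rel V := fun u v => `[< adj u v >].

Let e_sym : symmetric e.
Proof. by move=> u v; apply/asboolP/asboolP; apply: adj_sym. Qed.

Definition avoids v x y : Prop :=
  exists p, [/\ path e x p, last x p = y & v \notin x :: p].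

Lemma avoids_sym v x y : avoids v x y -> avoids v y x.
Proof.
move=> [p [ep <- vp]]; exists (rev (belast x p)); split.
- by rewrite rev_path; under eq_path do rewrite e_sym.
- by case: p {ep vp} => //= y0 p; rewrite rev_cons last_rcons.
- by rewrite -rev_rcons -lastI mem_rev.
Qed.

Lemma avoids_trans v x y z : avoids v x y -> avoids v y z -> avoids v x z.
Proof.
move=> [p [ep <- vp]] [q [eq <- vq]]; exists (p ++ q); split.
- by rewrite cat_path ep.
- by rewrite last_cat.
- by rewrite -cat_cons mem_cat negb_or vp; move: vq; rewrite inE negb_or => /andP[].
Qed.

(** A path from [u] to [w] avoiding [v], once shortened, closes up through [v] to a cycle. *)
Lemma no_detour v u w : adj v u -> adj v w -> avoids v u w -> u = w.
Proof.
move=> vu vw [p [ep lp vp]]; apply: contrapT => uw.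
case/shortenP: ep lp vp => q eqp uq qp lq vp.
have vq : v \notin u :: q.
  apply: contra vp; rewrite !inE => /orP[->//|/qp ->]; exact: orbT.
apply: acyclic; exists (size q).+2, (nth v [:: v, u & q]); split; last split; last split.
- by case: (q) lq => [/uw|].
- move=> i j iq jq /eqP; rewrite nth_uniq //; first by move/eqP.
  by rewrite cons_uniq vq.
- have eq' : path e v (u :: q) by rewrite /= eqp andbT; apply/asboolP.
  by move=> i iq; apply/asboolP; have /pathP := eq' => /(_ v i); apply; rewrite -ltnS.
- rewrite /= (_ : nth _ _ _ = w); first exact: adj_sym.
  by rewrite -lq -[RHS]/(last v (u :: q)) -nth_last.
Qed.

Definition reach n u v : Prop := exists p, [/\ path e u p, last u p = v & size p = n].

Lemma reachS n u v w : reach n u v -> adj v w -> reach n.+1 u w.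
Proof.
move=> [p [ep lp sp]] vw; exists (rcons p w); split.
- by rewrite rcons_path ep lp; apply/asboolP.
- by rewrite last_rcons.
- by rewrite size_rcons sp.
Qed.

(** Each component is rooted at its vertex of least key; [dep] is the distance from the root and
    [cl] its parity. By [no_detour] a vertex has at most one neighbour that is not farther from the
    root than itself. *)
Lemma rooting t : exists (par : V -> option V) (dep : V -> nat) (cl : V -> bool),
  [/\ par t = None, forall u v, adj u v <-> par u = Some v \/ par v = Some u,
      forall v u, par v = Some u -> dep v = (dep u).+1 &
      forall v u, par v = Some u -> cl v = ~~ cl u].
Proof.
(* Key 0 makes [t] the root of its component. *)
pose key v := if v == t then 0 else (idx v).+1.
have key_inj : injective key.
  move=> u v; rewrite /key; case: eqVneq => [->|_]; case: eqVneq => [->|_] //.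
  by move=> [/idx_inj].
have conn_ex v : exists n, `[< exists u, key u = n /\ exists m, reach m u v >].
  by exists (key v); apply/asboolP; exists v; split=> //; exists 0, [::].
have root_ex v : exists u, (exists m, reach m u v) /\
    forall w m, reach m w v -> key u <= key w.
  case: (ex_minnP (conn_ex v)) => n /asboolP[u [un uv]] Hn; exists u; split=> //.
  move=> w m wv; rewrite un; apply: Hn; apply/asboolP; exists w; split=> //.
  by exists m.
have [rt Hrt] := choice root_ex.
have rt_adj u v : adj u v -> rt u = rt v.
  move=> uv; apply/key_inj/eqP; rewrite eqn_leq.
  have [[mu Hmu] Hu] := Hrt u; have [[mv Hmv] Hv] := Hrt v.
  by rewrite (Hu _ mv.+1 (reachS Hmv (adj_sym uv))) (Hv _ mu.+1 (reachS Hmu uv)).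
have d_ex v : exists n, `[< reach n (rt v) v >].
  by have [[m Hm] _] := Hrt v; exists m; apply/asboolP.
pose d v := ex_minn (d_ex v).
have d_reach v : reach (d v) (rt v) v.
  by rewrite /d; case: ex_minnP => n /asboolP.
have d_min v n : reach n (rt v) v -> d v <= n.
  by move=> H; rewrite /d; case: ex_minnP => m _; apply; apply/asboolP.
have d_adj u v : adj u v -> d v <= (d u).+1.
  by move=> uv; apply: d_min; rewrite -(rt_adj _ _ uv); apply: reachS uv.
have rt_rt v : rt (rt v) = rt v.
  have H n u : reach n u v -> rt u = rt v.
    move=> [p [ep lp _]]; elim: p u ep lp => [|x p IH] u /=; first by move=> _ ->.
    by move=> /andP[/asboolP ux ep] lp; rewrite (rt_adj _ _ ux); apply: IH.
  exact: H (d_reach v).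
(* A shortest path from the root to [u] could meet [v] only at an index at least [d v], hence at its
   end, which would give [u = v]. *)
have avoid_rt v u : adj v u -> d u <= d v -> avoids v u (rt v).
  move=> vu duv; apply: avoids_sym.
  have [p [ep lp sp]] := d_reach u.
  rewrite (rt_adj _ _ vu); exists p; split=> //; apply/negP => vp.
  have vi := nth_index u vp; set i := index v (rt u :: p) in vi.
  have ip : i <= size p by move: vp; rewrite -index_mem ltnS.
  have : d v <= i.
    apply: d_min; rewrite (rt_adj _ _ vu); exists (take i p); split.
    - by rewrite -[p](cat_take_drop i) cat_path in ep; case/andP: ep.
    - case: (i) vi ip => [|j] /=; first by rewrite take0.
      by move=> <- jp; rewrite (last_nth u) size_takel //= nth_take.
    - by rewrite size_takel.
  rewrite sp in ip => dvi; have ie : i = size p.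
    by apply/eqP; rewrite eqn_leq sp ip (leq_trans duv dvi).
  have uv : u = v by rewrite -lp -vi ie -[RHS]/(nth _ (rt u :: p) (size p)) nth_last.
  by rewrite uv in vu; apply: adj_irr vu.
have up_uniq v u w : adj v u -> adj v w -> d u <= d v -> d w <= d v -> u = w.
  move=> vu vw du dw; apply: (no_detour vu vw).
  by apply: avoids_trans (avoid_rt v u vu du) _; apply: avoids_sym (avoid_rt v w vw dw).
have up_ex v : 0 < d v -> exists u, adj v u /\ d u < d v.
  move=> dv; have [p [ep lp sp]] := d_reach v.
  case/lastP: p ep lp sp => [_ _ d0|p x]; first by rewrite -d0 in dv.
  rewrite rcons_path last_rcons size_rcons => /andP[ep /asboolP lx] xv sp.
  rewrite xv in lx; exists (last (rt v) p); split; first exact: adj_sym.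
  by rewrite -sp ltnS; apply: d_min; rewrite (rt_adj _ _ lx); exists p.
have d_root v : d v = 0 -> rt v = v.
  by move=> dv; have := d_reach v; rewrite dv => -[[|x p] []].
have par_ex v : exists o : option V,
    if o is Some u then adj v u /\ d u < d v else d v = 0.
  have [->|/up_ex[u Hu]] := posnP (d v); first by exists None.
  by exists (Some u).
have [par Hpar] := choice par_ex.
have par_dep v u : par v = Some u -> d v = (d u).+1.
  move=> pv; have := Hpar v; rewrite pv => -[vu du].
  by apply/eqP; rewrite eqn_leq du d_adj //; apply: adj_sym.
have par_adj u v : adj u v -> d v <= d u -> par u = Some v.
  move=> uv dvu; have := Hpar u; case: (par u) => [w [uw /ltnW dw]|du].
    by rewrite (up_uniq _ _ _ uv uw dvu dw).
  rewrite du leqn0 in dvu; have rv := d_root v (eqP dvu); have ru := d_root u du.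
  by move: (uv); rewrite -ru (rt_adj _ _ uv) rv => /adj_irr.
exists par, d, (fun v => odd (d v)); split=> //.
- have rt_t : rt t = t.
    apply/key_inj/eqP; rewrite eqn_leq [in X in _ && X]/key eqxx andbT.
    by have [_ H] := Hrt t; apply: (H _ 0); exists [::].
  have dt : d t = 0.
    by apply/eqP; rewrite -leqn0; apply: d_min; exists [::]; rewrite rt_t.
  by have := Hpar t; case: (par t) => // u [_]; rewrite dt.
- move=> u v; split=> [uv|[pu|pv]].
  + case: (leqP (d v) (d u)) => duv; first by left; apply: par_adj.
    by right; apply: par_adj; [apply: adj_sym|apply: ltnW].
  + by have := Hpar u; rewrite pu => -[].
  + by have := Hpar v; rewrite pv => -[/adj_sym].
- by move=> v u /par_dep ->.
Qed.

End Graph.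

(** * Types of strongly contracting forests *)

Lemma atmost_seq (T : eqType) k (S : T -> Prop) : atmost k S ->
  exists s : seq T, size s <= k /\ forall x, S x -> x \in s.
Proof.
move=> [g Hg]; exists (codom g); rewrite size_codom card_ord; split=> // x /Hg[i <-].
exact: codom_f.
Qed.

Lemma seq_atmost (T : eqType) (s : seq T) (S : T -> Prop) :
  (forall x, S x -> x \in s) -> atmost (size s) S.
Proof.
move=> H; exists (tnth (in_tuple s)) => x /H/seq_tnthP[i ->].
by exists i.
Qed.

Lemma atmost_leq (T : Type) (x0 : T) k l (S : T -> Prop) :
  k <= l -> atmost k S -> atmost l S.
Proof.
move=> kl [g Hg]; exists (fun i : 'I_l => if insub (i : nat) is Some j then g j else x0).
move=> x /Hg[i <-]; exists (widen_ord kl i).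
by rewrite /= insubT //= => ik; congr g; apply: val_inj.
Qed.

Lemma infS_not_atmost (T : eqType) (S : T -> Prop) k : infS S -> ~ atmost k S.
Proof.
move=> iS /atmost_seq[s [_ Hs]]; have [x [xs /Hs]] := iS s.
by rewrite (negPf xs).
Qed.

Section Types.
Variables (V : choiceType) (adj : V -> V -> Prop).
Hypothesis adj_sym : forall u v, adj u v -> adj v u.
Hypothesis adj_irr : forall v, ~ adj v v.
Hypothesis acyclic : forest adj.

Definition gleaf v : Prop := exists w, forall u, adj v u <-> u = w.

Definition grich l x : Prop :=
  exists L : seq V, [/\ uniq L, l <= size L & forall y, y \in L -> adj x y /\ gleaf y].

Lemma grich_leq l m x : l <= m -> grich m x -> grich l x.
Proof.
by move=> lm [L [uL mL HL]]; exists L; split=> //; apply: leq_trans mL.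
Qed.

Lemma not_dominated : ~ has_finite_dominating_set adj ->
  forall D : seq V, exists v, v \notin D /\ forall u, u \in D -> ~ adj v u.
Proof.
move=> nd D; apply: contrapT => /forallNP H; apply: nd; exists (fun u => u \in D).
split; first by exists (size D); apply: seq_atmost.
move=> v vD; apply: contrapT => nex; apply: (H v); split; first exact/negP.
by move=> u uD vu; apply: nex; exists u.
Qed.

(** The path [x], [v], [y] avoids [u], a common neighbour of its ends. *)
Lemma no_square u v x y : adj x u -> adj x v -> adj y u -> adj y v -> u <> v -> x = y.
Proof.
move=> xu xv yu yv uv; apply: (no_detour adj_sym acyclic (adj_sym xu) (adj_sym yu) _).
exists [:: v; y]; split=> //=.
- by rewrite andbT; apply/andP; split; apply/asboolP => //; apply: adj_sym.
- have nadj a b : adj a b -> b == a = false.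
    by move=> ab; apply/eqP => ba; rewrite ba in ab; apply: adj_irr ab.
  by rewrite !inE (nadj x u xu) (nadj y u yu) (introF eqP uv).
Qed.

(** Otherwise the number of leaf neighbours is bounded by some M. A member of an independent set
    with at most [k] neighbours is isolated, or one of at most M leaves at one of these neighbours,
    or determined by a pair of them, as there are no squares. This bounds the size of the set. *)
Lemma contracting_rich l : strongly_contracting adj ->
  ~ infS (fun v => forall u, ~ adj v u) ->
  (forall t, ~ infS (fun x => adj t x /\ gleaf x)) ->
  infS (grich l).
Proof.
move=> [k Hk] /ninfS[I HI] nA; apply: contrapT => /ninfS[s Hs].
have leaves t : exists L : seq V, uniq L /\ forall x, adj t x /\ gleaf x <-> x \in L.
  have /ninfS[L HL] := nA t.
  exists (undup [seq x <- L | `[< adj t x /\ gleaf x >]]); split; first exact: undup_uniq.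
  move=> x; rewrite mem_undup mem_filter; split=> [H|/andP[/asboolP]//].
  by rewrite HL // andbT; apply/asboolP.
have [L HL] := choice leaves.
(* Bounds the leaf neighbours of every vertex: below [l] outside [s], and by the sum on [s]. *)
pose M := l + \sum_(t <- s) size (L t).
have sL t : size (L t) <= M.
  have [ts|ts] := boolP (t \in s).
    by apply: leq_trans (leq_addl _ _); rewrite (big_rem t) //= leq_addr.
  apply: leq_trans (leq_addr _ _); rewrite leqNgt; apply/negP => lL.
  move/negP: ts; apply; apply: Hs; have [uL HLt] := HL t.
  by exists (L t); split=> //; [apply: ltnW | move=> y /HLt].
have common u : exists com : V -> V, forall v x, adj x u -> adj x v -> u <> v -> com v = x.
  have H v : exists y, forall x, adj x u -> adj x v -> u <> v -> y = x.
    have [[y [yu yv uv]]|nex] := pselect (exists y, [/\ adj y u, adj y v & u <> v]).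
      by exists y => x xu xv _; apply: no_square yu yv xu xv uv.
    by exists u => x xu xv uv; case: nex; exists x.
  by have [com Hcom] := choice H; exists com => v; apply: Hcom.
have [com Hcom] := choice common.
pose N := size I + (k * M + k * k).
have [A [_ [[g [g_inj gA]] /atmost_seq[nb [snb Hnb]]]]] := Hk N.+1.
pose big := I ++ [seq nth y (L y) i | y <- nb, i <- iota 0 M] ++
            [seq com y z | y <- nb, z <- nb].
have sbig : size big <= N.
  rewrite !size_cat !size_allpairs size_iota leq_add2l.
  by apply: leq_add; apply: leq_mul.
have sub : {subset codom g <= big}.
  move=> _ /codomP[i ->]; rewrite !mem_cat.
  have [iso|/existsNP[u /contrapT au]] := pselect (forall u, ~ adj (g i) u).
    by rewrite HI.
  have nbP w : adj (g i) w -> w \in nb.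
    by move=> aw; apply: Hnb; exists (g i); first exact: gA.
  apply/orP; right; apply/orP.
  have [lf|nlf] := pselect (gleaf (g i)).
    have [uL HLu] := HL u; have gL : g i \in L u by apply/HLu; split=> //; apply: adj_sym.
    left; apply/allpairsP; exists (u, index (g i) (L u)) => /=; split.
    - exact: nbP.
    - rewrite mem_iota add0n /=; apply: leq_trans (sL u); by rewrite index_mem.
    - by rewrite nth_index.
  have [v [av uv]] : exists v, adj (g i) v /\ u <> v.
    apply: contrapT => /forallNP H; apply: nlf; exists u => w; split=> [aw|->//].
    by apply: contrapT => wu; apply: (H w); split=> // uw; apply: wu.
  right; apply/allpairsP; exists (u, v) => /=; split; [exact: nbP|exact: nbP|].
  exact/esym/Hcom.
have u_codom : uniq (codom g) by rewrite /codom map_inj_uniq ?enum_uniq.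
have := leq_trans (uniq_leq_size u_codom sub) sbig.
by rewrite size_codom card_ord ltnn.
Qed.

(** If the third alternative fails for D and [l0], almost all rich vertices have a neighbour in D.
    If moreover each [y] in D fails the fourth from some [ly y] on, pigeonholing at a level above
    [l0] and all these thresholds gives a contradiction. *)
Lemma contracting_types : strongly_contracting adj ->
  [\/ infS (fun v => forall u, ~ adj v u),
      exists t, infS (fun x => adj t x /\ gleaf x),
      forall (D : seq V) l, exists x,
        [/\ x \notin D, forall u, u \in D -> ~ adj x u & grich l x] |
      exists y, forall l, infS (fun x => adj y x /\ grich l x)].
Proof.
move=> sc; have [?|nI] := pselect (infS (fun v => forall u, ~ adj v u)); first by constructor 1.
have [?|/forallNP nA] := pselect (exists t, infS (fun x => adj t x /\ gleaf x)).
  by constructor 2.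
have ric l := contracting_rich l sc nI nA.
have [|/existsNP[D /existsNP[l0 nD]]] := pselect (forall (D : seq V) l, exists x,
  [/\ x \notin D, forall u, u \in D -> ~ adj x u & grich l x]); first by constructor 3.
constructor 4; apply: contrapT => /forallNP nT.
have bad y : exists l, ~ infS (fun x => adj y x /\ grich l x) by exact/existsNP/nT.
have [ly Hly] := choice bad.
pose l := l0 + \sum_(y <- D) ly y.
have iD : infS (fun x => grich l x /\ x \notin D).
  by apply: (infS_but (s := D) (ric l)) => x xD rx.
have [|y yD iy] := infS_pigeon (r := D) (R := fun y x => adj y x) iD.
  move=> x [rx xD]; apply: contrapT => nex; apply: nD; exists x; split=> //.
  - by move=> u uD xu; apply: nex; exists u => //; apply: adj_sym.
  - by apply: grich_leq rx; apply: leq_addr.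
apply: (Hly y); apply: infS_sub iy _ => x [[rx _] yx]; split=> //.
apply: grich_leq rx; apply: leq_trans (leq_addl _ _).
by rewrite (big_rem y) //= leq_addr.
Qed.

End Types.

(** * Almost spanning copies *)

Lemma far_sub (V : eqType) (par : V -> option V) j (D D' : seq V) v :
  {subset D <= D'} -> far par j D' v -> far par j D v.
Proof.
move=> DD'; elim: j v => // j IH v /= [vD' H]; split.
  by apply: contra vD'; apply: DD'.
by case: (par v) H.
Qed.

Lemma parent_closure (V : eqType) (par : V -> option V) (dep : V -> nat) (D : seq V) :
  (forall v u, par v = Some u -> dep v = (dep u).+1) ->
  exists D' : seq V, {subset D <= D'} /\ forall v u, v \in D' -> par v = Some u -> u \in D'.
Proof.
move=> dep_par.
have one x : exists D' : seq V, x \in D' /\ forall v u, v \in D' -> par v = Some u -> u \in D'.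
  have [n] := ubnP (dep x); elim: n x => // n IH x; rewrite ltnS => xn.
  case px : (par x) => [u|]; last first.
    exists [:: x]; rewrite mem_head; split=> // v u.
    by rewrite inE => /eqP->; rewrite px.
  have [|D' [uD' HD']] := IH u; first by rewrite -(dep_par _ _ px).
  exists (x :: D'); rewrite mem_head; split=> // v w.
  rewrite !inE => /orP[/eqP->|vD' pv]; last by rewrite (HD' v w) ?orbT.
  by rewrite px => -[<-]; rewrite uD' orbT.
elim: D => [|x D [D' [DD' HD']]]; first by exists [::].
have [D1 [xD1 HD1]] := one x; exists (D1 ++ D'); split.
  by move=> y; rewrite inE mem_cat => /orP[/eqP->|/DD'->]; rewrite ?xD1 ?orbT.
move=> v u; rewrite !mem_cat => /orP[vD|vD] pv.
- by rewrite (HD1 v).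
- by rewrite (HD' v) ?orbT.
Qed.

Section Spanning.
Variables (V : choiceType) (adj : V -> V -> Prop) (idx : V -> nat).
Hypothesis idx_inj : injective idx.
Hypothesis adj_sym : forall u v, adj u v -> adj v u.
Hypothesis adj_irr : forall v, ~ adj v v.
Hypothesis acyclic : forest adj.
Variable c : nat -> nat -> bool.
Hypothesis c_sym : forall x y, c x y = c y x.

Definition graph_spans : Prop :=
  exists (b : bool) (f : V -> nat) (s : seq nat), [/\ injective f, forall v, 0 < f v,
    forall u v, adj u v -> c (f u) (f v) = b &
    forall w, 0 < w -> w \notin s -> exists v, f v = w].

Let rooted := rooting idx_inj adj_sym adj_irr acyclic.

Section Rooted.
Variables (par : V -> option V) (dep : V -> nat) (cl : V -> bool).
Hypothesis adj_par : forall u v, adj u v <-> par u = Some v \/ par v = Some u.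
Hypothesis dep_par : forall v u, par v = Some u -> dep v = (dep u).+1.

Lemma spans_graph : spans par c -> graph_spans.
Proof.
move=> [b [f [s [f_inj f0 fE fW]]]]; exists b, f, s; split=> //.
by move=> u v /adj_par[/fE|/fE//]; rewrite c_sym.
Qed.

Lemma adj_child v x : adj v x -> par v != Some x -> par x = Some v.
Proof. by move=> /adj_par[->|//]; rewrite eqxx. Qed.

Lemma adj_root t x : par t = None -> adj t x -> par x = Some t.
Proof. by move=> pt /adj_child; rewrite pt; apply. Qed.

Lemma gleaf_nochild x y : gleaf adj y -> par y = Some x -> nochild par y.
Proof.
move=> [w Hw] py z pz; have xw : x = w by apply/Hw/adj_par; left.
have zw : z = w by apply/Hw/adj_par; right.
have := dep_par pz; rewrite zw -xw (dep_par py) => /eqP.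
by rewrite eqn_leq andbC ltnNge leqnSn.
Qed.

(** One leaf neighbour is lost if it is the parent of [x]. *)
Lemma grich_rich l x : grich adj l.+1 x -> rich par l x.
Proof.
move=> [L [uL lL HL]]; exists (if par x is Some z then rem z L else L); split.
- by case: (par x) => // z; apply: rem_uniq.
- case: (par x) => [z|]; last exact: ltnW.
  have [zL|zL] := boolP (z \in L); first by rewrite size_rem // -ltnS prednK ?(leq_trans _ lL).
  by rewrite rem_id //; apply: ltnW.
- move=> y yL; have [yL' pxy] : y \in L /\ par x != Some y.
    case: (par x) yL => [z|//]; rewrite mem_rem_uniq // !inE => /andP[yz ->].
    by split=> //; apply: contraNneq yz => -[->].
  have [xy ly] := HL y yL'; have py := adj_child xy pxy.
  by split=> //; apply: gleaf_nochild ly py.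
Qed.

Lemma far2_nonadjacent (D : seq V) x :
  x \notin D -> (forall u, u \in D -> ~ adj x u) -> far par 2 D x.
Proof.
move=> xD H; split=> //; case px : (par x) => [u|//]; split; last by case: (par u).
by apply/negP => /H; apply; apply/adj_par; left.
Qed.

End Rooted.

Lemma rich_center_spans y0 :
  (forall l, infS (fun x => adj y0 x /\ grich adj l x)) -> graph_spans.
Proof.
move=> Hy; have [par [dep [cl [py ap dp cp]]]] := rooted y0.
apply: (spans_graph ap); apply: (rich_root_spans idx_inj dp cp py _ c_sym) => l.
apply: infS_sub (Hy l.+1) _ => x [yx rx]; split; first exact: adj_root py yx.
exact: (grich_rich ap dp).
Qed.

Lemma isolated_graph_spans : infS (fun v => forall u, ~ adj v u) -> graph_spans.
Proof.
move=> iI; have [t _] := iI [::].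
have [par [dep [cl [_ ap dp cp]]]] := rooted t.
have [b [K [iK K0 K2 KR]]] := cohesive_set c.
apply: (spans_graph ap).
apply: (isolated_spans iK K0 KR idx_inj dp cp).
apply: infS_sub iI _ => v iso; split.
- by case pv : (par v) => [u|//]; case: (iso u); apply/ap; left.
- by move=> u pu; apply: (iso u); apply/ap; right.
Qed.

(** If few vertices of R are red to almost all of B, the blue bipartite embedding applies. It needs
    far vertices with children in one fixed class: if a finite set blocks this for one class, all
    far rich vertices beyond that set lie in the other, and the classes are exchanged. *)
Lemma far_rich_graph_spans :
  (forall (D : seq V) l, exists x,
     [/\ x \notin D, forall u, u \in D -> ~ adj x u & grich adj l x]) ->
  graph_spans.
Proof.
move=> nd; have [t _] := nd [::] 0.
have [par [dep [cl [_ ap dp cp]]]] := rooted t.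
have [b [K [iK K0 K2 KR]]] := cohesive_set c.
have nd' (D : seq V) l : exists x, far par 2 D x /\ rich par l x.
  have [x [xD Hx rx]] := nd D l.+1; exists x; split; last exact: grich_rich ap dp _ _ rx.
  exact: far2_nonadjacent ap _ _ xD Hx.
apply: (spans_graph ap).
have [iQ|/ninfS[s Hs]] := pselect (infS (fun r => mostly_red c b K r /\ almost (mostly_blue c b K) (red c b r))).
  exact: (far_rich_spans c_sym iK K0 KR idx_inj dp cp nd' iQ).
have blue_B r : mostly_red c b K r -> r \notin s -> infS (fun n => mostly_blue c b K n /\ blue c b r n).
  move=> Rr rs; have nQ : ~ almost (mostly_blue c b K) (red c b r).
    by move=> H; move/negP: rs; apply; apply: Hs.
  by apply: infS_sub (not_almost nQ) _ => n [Bn /negP]; rewrite redN.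
have child x : rich par 1 x -> exists y, par y = Some x.
  move=> [[|y L] [_ // _ H]]; exists y.
  by have [] := H y (mem_head _ _).
have [ndt|/existsNP[D1 nD1]] := pselect (forall D : seq V, exists x,
    [/\ cl x = true, far par 2 D x & exists y, par y = Some x]).
  exact: (bipartite_spans c_sym iK K0 K2 KR idx_inj dp cp blue_B ndt).
apply: (@bipartite_spans _ _ _ c_sym iK K0 K2 KR _ idx par dep (fun v => ~~ cl v)
  idx_inj dp _ s blue_B) => [v u /cp->//|D].
have [x [fx /child xy]] := nd' (D1 ++ D) 1.
have fxD : far par 2 D x by apply: far_sub fx => y; rewrite mem_cat orbC => ->.
exists x; split=> //; case clx : (cl x) => //; case: nD1; exists x; split=> //.
by apply: far_sub fx => y; rewrite mem_cat => ->.
Qed.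

(* If some finite set D dominates the class of t, then no finite set dominates the
   other class, and D contains a vertex of that class of infinite degree. *)
Lemma center_of_undominated_class (cl : V -> bool) t :
  (forall u v, adj u v -> cl v = ~~ cl u) ->
  ~ infS (fun v => forall u, ~ adj v u) ->
  (forall D : seq V, exists v, v \notin D /\ forall u, u \in D -> ~ adj v u) ->
  infS (adj t) ->
  exists t', infS (adj t') /\ forall D : seq V, exists x,
    [/\ cl x = cl t', x \notin D & forall u, u \in D -> ~ adj x u].
Proof.
move=> cl_adj /ninfS[I HI] nd it.
have [?|/existsNP[D nD]] := pselect (forall D : seq V, exists x,
    [/\ cl x = cl t, x \notin D & forall u, u \in D -> ~ adj x u]); first by exists t.
have dom x : cl x = cl t -> x \notin D -> exists2 u, u \in D & adj x u.
  move=> clx xD; apply: contrapT => nex; apply: nD; exists x; split=> // u uD xu.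
  by apply: nex; exists u.
(* Otherwise a vertex undominated by a large finite set has a neighbour outside that set, and one of
   the two is a new member of the class of [t]. *)
have iX : infS (fun x => cl x = cl t /\ x \notin D).
  apply: contrapT => /ninfS[L HL].
  have [v [+ Hv]] := nd (D ++ I ++ L); rewrite !mem_cat !negb_or => /and3P[vD vI vL].
  have [/HI|/existsNP[u /contrapT vu]] := pselect (forall u, ~ adj v u).
    by rewrite (negPf vI).
  have uDL : u \notin D ++ I ++ L by apply/negP => /Hv.
  move: uDL; rewrite !mem_cat !negb_or => /and3P[uD uI uL].
  have [clv|clv] := eqVneq (cl v) (cl t).
    by move/negP: vL; apply; apply: HL.
  move/negP: uL; apply; apply: HL; split=> //.
  by rewrite (cl_adj _ _ vu); case: (cl v) (cl t) clv => -[].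
have [|y yD iy] := infS_pigeon (r := D) (R := fun y x => adj y x) iX.
  by move=> x [/dom H /H[u uD xu]]; exists u => //; apply: adj_sym.
exists y; split; first by apply: infS_sub iy _ => x [].
have [x [_ [[clx _] yx]]] := iy [::].
have cly : cl y = ~~ cl t by rewrite (cl_adj _ _ (adj_sym yx)) clx.
move=> D'; have [v [vD Hv]] := nd (D ++ D'); exists v.
move: vD; rewrite mem_cat negb_or => /andP[vD vD'].
have Hv' (E : seq V) : {subset E <= D ++ D'} -> forall u, u \in E -> ~ adj v u.
  by move=> ED u /ED/Hv.
split=> //; last by apply: Hv' => u; rewrite mem_cat orbC => ->.
rewrite cly; case: (eqVneq (cl v) (cl t)) => [clv|]; last by case: (cl v) (cl t) => -[].
have [u uD vu] := dom v clv vD; case: (Hv' D _ u uD vu) => w.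
by rewrite mem_cat => ->.
Qed.

(** If all alternatives fail, T lies in T*. Failure of the first two puts every vertex at most two
    levels below a finite set. As no finite set dominates, some [t1] in it has infinitely many
    children with children. Failure of the third makes [t1] the only vertex of infinite degree, so
    it is [t], and failure of the fourth bounds the other degrees. *)
Lemma leaf_center_types (par : V -> option V) (dep : V -> nat) t :
  (forall u v, adj u v <-> par u = Some v \/ par v = Some u) ->
  (forall v u, par v = Some u -> dep v = (dep u).+1) ->
  par t = None -> infS (fun x => adj t x /\ gleaf adj x) ->
  (forall D : seq V, exists v, v \notin D /\ forall u, u \in D -> ~ adj v u) ->
  ~ in_Tstar adj ->
  [\/ forall D : seq V, exists v, far par 4 D v,
      exists s, infS (fun x => par x = Some s /\ exists v, anc par 2 v = Some x),
      exists t1 t2, [/\ t2 != t1, infS (fun x => adj t1 x /\ exists y, y <> t1 /\ adj x y) &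
                        infS (adj t2)] |
      exists y, forall l, infS (fun x => adj y x /\ grich adj l x)].
Proof.
move=> ap dp pt iL nd nT.
have [|/existsNP[D0 nD0]] := pselect (forall D : seq V, exists v, far par 4 D v).
  by constructor 1.
have [|/forallNP nS] := pselect (exists s,
    infS (fun x => par x = Some s /\ exists v, anc par 2 v = Some x)).
  by constructor 2.
have [|n12] := pselect (exists t1 t2,
    [/\ t2 != t1, infS (fun x => adj t1 x /\ exists y, y <> t1 /\ adj x y) & infS (adj t2)]).
  by constructor 3.
constructor 4; apply: contrapT => /forallNP nR; apply: nT.
have par_adj v u : par v = Some u -> adj v u by move=> pv; apply/ap; left.
have [S [D0S S_par]] := parent_closure D0 dp.
have not4 v : ~ far par 4 S v by move=> /(far_sub D0S) fv; apply: nD0; exists v.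
have [C HC] := choice (fun s => ninfS (nS s)).
(* Contains every child of a member of S that has a grandchild, so vertices three levels below S are
   at most two levels below S2. *)
pose S2 := S ++ flatten [seq [seq x <- C s | par x == Some s] | s <- S].
have inS2 s x v : s \in S -> par x = Some s -> anc par 2 v = Some x -> x \in S2.
  move=> sS px vx; rewrite mem_cat; apply/orP; right.
  apply/flatten_mapP; exists s => //; rewrite mem_filter px eqxx.
  by apply: HC; split=> //; exists v.
have S2_par v u : v \in S2 -> par v = Some u -> u \in S2.
  rewrite mem_cat => /orP[vS pv|/flatten_mapP[s sS]].
    by rewrite mem_cat (S_par v u).
  by rewrite mem_filter => /andP[/eqP -> _] [<-]; rewrite mem_cat sS.
have nS2 v : v \notin S2 -> v \notin S by rewrite mem_cat negb_or => /andP[].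
have not3 v : ~ far par 3 S2 v.
  move=> [/[dup] vS2 /nS2 vS]; case pv : (par v) => [g|]; last first.
    by move=> _; apply: (not4 v); split=> //; rewrite pv.
  move=> [/nS2 gS]; case pg : (par g) => [g2|]; last first.
    by move=> _; apply: (not4 v); split=> //; rewrite pv; split=> //; rewrite pg.
  move=> [/[dup] g2S2 /nS2 g2S _]; apply: (not4 v); split=> //; rewrite pv; split=> //.
  rewrite pg; split=> //; case pg2 : (par g2) => [g3|//]; split; last by case: (par g3).
  apply: contra g2S2 => g3S; apply: (inS2 _ _ v g3S pg2).
  by rewrite /= pv /= pg.
have near v : v \notin S2 -> exists u, u \in S2 /\
    (par v = Some u \/ exists w, [/\ par v = Some w, w \notin S2 & par w = Some u]).
  move=> vS; case pv : (par v) => [w|]; last by case: (not3 v); split=> //; rewrite pv.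
  have [wS|wS] := boolP (w \in S2); first by exists w; split=> //; left.
  case pw : (par w) => [u|]; last first.
    by case: (not3 v); split=> //; rewrite pv; split=> //; rewrite pw.
  have [uS|uS] := boolP (u \in S2); first by exists u; split=> //; right; exists w.
  case: (not3 v); split=> //; rewrite pv; split=> //; rewrite pw; split=> //.
  by case: (par u).
have [t1 [t1S it1]] : exists t1, t1 \in S2 /\
    infS (fun x => par x = Some t1 /\ exists y, par y = Some x).
  apply: contrapT => /forallNP nt.
  have ex s : exists l : seq V, s \in S2 ->
      forall x, par x = Some s /\ (exists y, par y = Some x) -> x \in l.
    have [sS|sS] := boolP (s \in S2); last by exists [::].
    have /ninfS[l Hl] : ~ infS (fun x => par x = Some s /\ exists y, par y = Some x).
      by move=> H; apply: (nt s).
    by exists l.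
  have [N HN] := choice ex.
  have [v [+ Hv]] := nd (S2 ++ flatten [seq N s | s <- S2]).
  rewrite mem_cat negb_or => /andP[vS2 vN].
  have [u [uS [pv|[w [pv wS pw]]]]] := near v vS2.
    by case: (Hv u); [rewrite mem_cat uS | apply: par_adj].
  case: (Hv w); last exact: par_adj.
  rewrite mem_cat; apply/orP; right; apply/flatten_mapP; exists u => //.
  by apply: HN => //; split=> //; exists v.
have it1' : infS (fun x => adj t1 x /\ exists y, y <> t1 /\ adj x y).
  apply: infS_sub it1 _ => x [px [y py]]; split; first by apply/ap; right.
  exists y; split; last by apply/ap; right.
  move=> yt; have := dp _ _ py; rewrite yt (dp _ _ px) => /eqP.
  by rewrite eqn_leq andbC ltnNge leqnSn.
have only t2 : t2 != t1 -> ~ infS (adj t2).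
  by move=> t21 it2; apply: n12; exists t1, t2.
have it : infS (adj t) by apply: infS_sub iL _ => x [].
have {t1S} tt1 : t1 = t by apply: contrapT => /eqP; rewrite eq_sym => /only; apply.
subst t1.
have nbrs v : exists l : seq V, v != t -> forall x, adj v x -> x \in l.
  have [->|vt] := eqVneq v t; first by exists [::].
  by have /ninfS[l Hl] := only v vt; exists l.
have [N HN] := choice nbrs.
have /existsNP[l /ninfS[L HL]] := nR t.
pose N2 (D : seq V) := flatten [seq N s | s <- D & s != t].
have inN2 D s x : s \in D -> s != t -> adj s x -> x \in N2 D.
  move=> sD st sx; apply/flatten_mapP; exists s; first by rewrite mem_filter st.
  exact: HN.
pose X := S2 ++ N2 S2 ++ L.
split=> //; exists t; split; first by move=> k; apply: infS_not_atmost.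
split; [|split; [|split]].
(* Outside the finite set X, a child of [t] has fewer than [l] children, all of them leaves, since
   it is not in L; any other vertex outside X is a leaf. *)
- exists (l.+1 + \sum_(v <- X) size (N v)) => v /eqP vt.
  have [vX|vX] := boolP (v \in X).
    apply: (atmost_leq t (k := size (N v))); last by apply: seq_atmost; apply: HN.
    by apply: leq_trans (leq_addl _ _); rewrite (big_rem v) //= leq_addr.
  apply: (atmost_leq t (k := l.+1)); first exact: leq_addr.
  move: vX; rewrite mem_cat negb_or => /andP[vS2].
  rewrite mem_cat negb_or => /andP[vN2 vL].
  have child_S2 z w : par z = Some w -> w \notin S2 -> z \notin S2.
    by move=> pz; apply: contra => zS; apply: S2_par zS pz.
  have [u [uS [pv|[w [pv wS pw]]]]] := near v vS2.
    have ut : u = t.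
      apply: contrapT => /eqP ut; move/negP: vN2; apply.
      by apply: inN2 uS ut _; apply/ap; right.
    subst u.
    pose Ch := undup [seq z <- N v | par z == Some v].
    have sCh : size Ch < l.
      rewrite ltnNge; apply/negP => lCh; move/negP: vL; apply; apply: HL.
      split; first by apply/ap; right.
      exists Ch; split; [exact: undup_uniq|exact: lCh|].
      move=> z; rewrite mem_undup mem_filter => /andP[/eqP pz _].
      split; first by apply/ap; right.
      exists v => y; split=> [/ap[|py]|->]; last by apply: par_adj.
        by rewrite pz => -[].
      case: (not3 y); have zS := child_S2 _ _ pz vS2.
      split; first exact: child_S2 py zS.
      by rewrite py; split=> //; rewrite pz; split=> //; case: (par v).
    apply: (atmost_leq t (k := size (t :: Ch))); first exact: leqW.
    apply: seq_atmost => x vx.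
    rewrite inE; move: (vx) => /ap[|px]; first by rewrite pv => -[->]; rewrite eqxx.
    by rewrite mem_undup mem_filter px eqxx HN ?orbT.
  apply: (atmost_leq t (k := size [:: w])) => //; apply: seq_atmost => x /ap[|px].
    by rewrite pv => -[->]; rewrite mem_head.
  case: (not3 x); split; first exact: child_S2 px vS2.
  by rewrite px; split=> //; rewrite pv; split=> //; case: (par w).
- move=> k; apply: infS_not_atmost; apply: infS_sub iL _ => x [tx [w Hw]].
  split=> //; split; last by exists w; apply/Hw.
  by apply: (@seq_atmost _ [:: w]) => y /Hw ->; rewrite mem_head.
- move=> k; apply: infS_not_atmost; apply: infS_sub it1 _ => x [px [y py]].
  split; first by apply/ap; right.
  move=> [/atmost_seq[s [ss Hs]] _].
  have ts : t \in s by apply/Hs/ap; left.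
  have ys : y \in s by apply/Hs/ap; right.
  case: s ss ts ys {Hs} => [//|z [|//]] _; rewrite !inE => /eqP <- /eqP yt.
  by rewrite yt pt in py.
- exists (size (S2 ++ N2 S2 ++ N2 (N2 S2))); apply: seq_atmost => v Hv.
  rewrite mem_cat [v \in N2 S2 ++ _]mem_cat.
  have [//|vS2] := boolP (v \in S2).
  have [u [uS [pv|[w [pv wS pw]]]]] := near v vS2.
    have uv : adj u v by apply/ap; right.
    rewrite (inN2 S2 u) ?orbT //; apply/eqP => ut.
    by apply: Hv; right; left; rewrite -ut.
  have uw : adj u w by apply/ap; right.
  have wv : adj w v by apply/ap; right.
  rewrite (inN2 (N2 S2) w) ?orbT //.
    apply: (inN2 S2 u) => //; apply/eqP => ut.
    by apply: Hv; right; right; exists w; rewrite -?ut.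
  by apply/eqP => wt; rewrite wt pt in pw.
Qed.

(** A vertex of R red to almost all of B gives a red star at [t]. Otherwise, a vertex of B with few
    red neighbours in R gives a blue star at a centre whose class no finite set dominates. Otherwise
    all mixed neighbourhoods are infinite and [leaf_center_types] decides. *)
Lemma leaf_center_graph_spans t :
  infS (fun x => adj t x /\ gleaf adj x) ->
  ~ infS (fun v => forall u, ~ adj v u) ->
  (forall D : seq V, exists v, v \notin D /\ forall u, u \in D -> ~ adj v u) ->
  ~ in_Tstar adj -> graph_spans.
Proof.
move=> iL nI nd nT.
have [par [dep [cl [pt ap dp cp]]]] := rooted t.
have [b [K [iK K0 K2 KR]]] := cohesive_set c.
have cl_adj u v : adj u v -> cl v = ~~ cl u.
  by move=> /ap[/cp->|/cp//]; rewrite negbK.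
have [[q [Rq Bq]]|/forallNP nq] :=
    pselect (exists q, mostly_red c b K q /\ almost (mostly_blue c b K) (red c b q)).
  apply: (spans_graph ap); apply: (star_spans c_sym iK K0 KR idx_inj dp cp pt _ _ Rq Bq).
  - apply: infS_sub iL _ => x [tx lx]; have px := adj_root ap pt tx.
    by split=> //; apply: gleaf_nochild ap dp _ _ lx px.
  - move=> D; have [v [vD Hv]] := nd D; exists v.
    exact: far2_nonadjacent ap _ _ vD Hv.
have blue_B r : mostly_red c b K r -> infS (fun n => mostly_blue c b K n /\ blue c b r n).
  move=> Rr; have nQ : ~ almost (mostly_blue c b K) (red c b r) by move=> H; apply: (nq r).
  by apply: infS_sub (not_almost nQ) _ => n [Bn /negP]; rewrite redN.
have [[r0 [Br0 /ninfS[s Hs]]]|/forallNP nr] := pselect (exists r0, mostly_blue c b K r0 /\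
    ~ infS (fun n => mostly_red c b K n /\ red c b r0 n)).
  have it : infS (adj t) by apply: infS_sub iL _ => x [].
  have [t' [it' nd']] := center_of_undominated_class cl_adj nI nd it.
  have [par' [dep' [_ [pt' ap' dp' _]]]] := rooted t'.
  apply: (spans_graph ap').
  apply: (@bipartite_star_spans _ _ _ c_sym iK K0 K2 KR _ idx par' dep'
    (fun v => cl v == cl t') idx_inj dp' _ s _ t' r0 pt' _ _ _ Br0).
  - move=> v u pv; have uv : adj u v by apply/ap'; right.
    by rewrite (cl_adj _ _ uv); case: (cl u) (cl t') => -[].
  - by move=> r Rr _; apply: blue_B.
  - exact: eqxx.
  - by apply: infS_sub it' _ => x; apply: adj_root ap' _ _ pt'.
  - move=> D; have [x [clx xD Hx]] := nd' D; exists x; rewrite clx eqxx; split=> //.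
    exact: far2_nonadjacent ap' _ _ xD Hx.
  - move=> r Rr rs; rewrite -redN; apply/negP => rr; move/negP: rs; apply.
    exact: Hs.
have red_R w : mostly_blue c b K w -> infS (fun n => mostly_red c b K n /\ red c b w n).
  by move=> Bw; apply: contrapT => nw; apply: (nr w).
have [f4|[s sdeep]|[t1 [t2 [t21 it1 it2]]]|[y Hy]] := leaf_center_types ap dp pt iL nd nT.
- by apply: (spans_graph ap); apply: (far4_spans c_sym iK K0 KR idx_inj dp cp red_R f4).
- by apply: (spans_graph ap); apply: (deep_star_spans c_sym iK K0 KR idx_inj dp cp red_R sdeep).
- have [par' [dep' [cl' [pt' ap' dp' cp']]]] := rooted t1.
  apply: (spans_graph ap').
  apply: (@two_stars_span _ _ _ c_sym iK K0 K2 KR _ idx par' dep'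
    (fun v => cl' v == cl' t1) idx_inj dp' _ red_R blue_B t1 t2 pt' _ t21).
  + by move=> v u /cp' ->; case: (cl' u) (cl' t1) => -[].
  + exact: eqxx.
  + apply: infS_sub it1 _ => x [t1x [y [yt xy]]].
    have px := adj_root ap' pt' t1x; split=> //; exists y.
    by apply: (adj_child ap') xy _; rewrite px; apply/eqP => -[/esym].
  (* All neighbours of [t2] but its parent become children. *)
  + apply: (infS_but (s := if par' t2 is Some z then [:: z] else [::]) it2) => x xz t2x.
    apply: (adj_child ap') t2x _; case: (par' t2) xz => [z|//].
    by rewrite inE; apply: contraNneq => -[->].
- exact: rich_center_spans Hy.
Qed.

Theorem contracting_graph_spans :
  strongly_contracting adj -> ~ has_finite_dominating_set adj -> ~ in_Tstar adj ->
  graph_spans.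
Proof.
move=> sc /not_dominated nd nT.
have [|nI] := pselect (infS (fun v => forall u, ~ adj v u)).
  exact: isolated_graph_spans.
have [//|[t it]|nrich|[y Hy]] := contracting_types adj_sym adj_irr acyclic sc.
- exact: leaf_center_graph_spans it nI nd nT.
- exact: far_rich_graph_spans nrich.
- exact: rich_center_spans Hy.
Qed.

End Spanning.

(** * Sparse copies *)

(** Lower density 0 in integer terms: the density is at most 1/n at some [t] beyond [n]. *)
Definition sparse (W : nat -> Prop) : Prop :=
  forall n, exists t, [/\ n <= t, 0 < t & n * (\sum_(1 <= i < t.+1) (asbool (W i) : nat)) <= t].

Lemma sparse_not_cofinite (W : nat -> Prop) : sparse W -> ~ cofinite_in_N W.
Proof.
move=> sW [n0 H]; have [t [nt t0]] := sW n0.*2.+2.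
suff : t - n0 <= \sum_(1 <= i < t.+1) (asbool (W i) : nat) by lia.
rewrite (big_cat_nat (n := n0.+1)) //=; last lia.
apply: leq_trans (leq_addl _ _).
rewrite big_nat_cond (eq_bigr (fun=> 1)) -?big_nat_cond.
  by rewrite sum_nat_const_nat; lia.
by move=> i /andP[/andP[/ltnW/H Wi _] _]; rewrite asboolT.
Qed.

(** * Fast growing blocks *)

Section Blocks.
Variable g : nat -> nat -> nat.

(** Block [n] ends just before [start n.+1], which is so large that a set with at most
    [g n (start n)] elements in the block has density at most 1/(n+1) there. *)
Fixpoint start (n : nat) : nat :=
  if n is n'.+1 then n'.+1 * (start n' + g n' (start n') + 2) else 0.

Lemma start_lt n : start n < start n.+1.
Proof. by rewrite /= mulSn; lia. Qed.

Lemma start_mono m n : m <= n -> start m <= start n.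
Proof.
elim: n => [|n IH]; first by rewrite leqn0 => /eqP->.
rewrite leq_eqVlt => /orP[/eqP->//|/IH H].
exact: leq_trans H (ltnW (start_lt n)).
Qed.

Lemma start_ge n : n <= start n.
Proof. by elim: n => // n IH; apply: leq_ltn_trans IH (start_lt n). Qed.

Lemma block_ex x : exists n, x < start n.+1.
Proof. by exists x; apply: start_ge. Qed.

Definition block x := ex_minn (block_ex x).

Lemma leq_block n x : (n <= block x) = (start n <= x).
Proof.
rewrite /block; case: ex_minnP => m xm Hm; apply/idP/idP => H.
- rewrite leqNgt; apply/negP; case: n H => // n nm /Hm; rewrite leqNgt; exact/negP/negPn.
- rewrite leqNgt; apply/negP => mn.
  by have := leq_trans xm (leq_trans (start_mono mn) H); rewrite ltnn.
Qed.

Lemma block_eq n x : (block x == n) = (start n <= x < start n.+1).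
Proof. by rewrite eqn_leq leq_block andbC ltnNge -(leq_block n.+1) -leqNgt. Qed.

Lemma sparse_blocks (W : nat -> Prop) :
  (forall N, exists n, N <= n /\ exists s : seq nat,
     size s <= g n (start n) /\ forall x, W x -> block x = n -> x \in s) ->
  sparse W.
Proof.
move=> H N; have [n [Nn [s [ss Hs]]]] := H N.
exists (start n.+1); split.
- by apply: leq_trans Nn _; apply: ltnW (start_ge n.+1).
- by apply: leq_trans (start_ge n.+1).
rewrite [X in _ <= X]/= leq_mul //; first exact: leqW.
set t := start n.+1.
have -> : \sum_(1 <= i < t.+1) (asbool (W i) : nat) = size [seq i <- iota 1 t | asbool (W i)].
  by rewrite size_filter -sum1_count [RHS]big_mkcond /index_iota subn1 /=; apply: eq_bigr => i _; case: asbool.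
(* The point [t] already belongs to the next block, hence the extra entry in the list. *)
have : size [seq i <- iota 1 t | asbool (W i)] <= size (iota 1 (start n) ++ t :: s).
  apply: uniq_leq_size; first by rewrite filter_uniq ?iota_uniq.
  move=> x; rewrite mem_filter mem_iota mem_cat mem_iota inE => /andP[/asboolP Wx /andP[x1 xt]].
  rewrite x1 /= add1n ltnS; have [//|nx] := leqP x (start n).
  have [//|/eqP xt'] := eqVneq x t; rewrite Hs //.
  by apply/eqP; rewrite block_eq (ltnW nx) ltn_neqAle; move: xt; rewrite add1n ltnS => ->; rewrite andbT; apply/eqP.
by move=> /leq_trans; apply; rewrite size_cat size_iota /=; lia.
Qed.

End Blocks.

Lemma size_flatten_map (I T : Type) (F : I -> seq T) d (s : seq I) :
  (forall i, size (F i) <= d) -> size (flatten (map F s)) <= size s * d.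
Proof.
by move=> Fd; elim: s => //= i s IH; rewrite size_cat mulSn leq_add.
Qed.

Section Sparse.
Variables (V : choiceType) (adj : V -> V -> Prop).
Hypothesis adj_sym : forall u v, adj u v -> adj v u.

Definition sparsely_colored : Prop :=
  exists c, edge_coloring c /\ forall f : V -> nat, copy f -> monochromatic adj c f ->
    sparse (fun n => exists v, f v = n).

(** The smaller end decides the colour, so in a block of the wrong parity the copy's vertices have
    all their neighbours before the block. They form an independent set with at most [start n]
    neighbours, whose size weak expansion bounds by [l (start n)]. *)
Lemma expanding_sparse : weakly_expanding adj -> sparsely_colored.
Proof.
move=> /choice[l Hl]; pose g (n k : nat) := l k.
exists (fun x y => odd (block g (minn x y))).
split=> [x y|f [f_inj _] [b fb]]; first by rewrite minnC.
apply: (sparse_blocks (g := g)) => N; pose n := ~~ b + N.*2.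
have on : odd n = ~~ b by rewrite oddD odd_double addbF; case: (b).
exists n; split; first by rewrite /n; lia.
pose A v := block g (f v) = n.
have A_nbr u v : A u -> adj u v -> f v < start g n.
  move=> Au uv; have := fb u v uv; rewrite ltnNge -leq_block.
  have [fuv|fvu] := leqP (f u) (f v).
    by rewrite Au on; case: (b).
  move=> ov; apply/negP => nv; suff bv : block g (f v) = n by rewrite bv on in ov; case: (b) ov.
  apply/eqP; rewrite eqn_leq nv andbT -ltnS -Au ltnS leq_block.
  by apply: leq_trans (ltnW fvu); rewrite -leq_block.
have [[x0 Ax0]|/forallNP nA] := pselect (exists v, A v); last first.
  by exists [::]; split=> // _ [v <-] /nA.
have indA : independent adj A.
  move=> u v Au Av uv; have := A_nbr u v Au uv.
  by rewrite ltnNge -leq_block Av leqnn.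
have fewN : atmost (start g n) (nbhd_set adj A).
  have inv k : exists v, forall u, f u = k -> v = u.
    have [[v fv]|nv] := pselect (exists v, f v = k).
      by exists v => u fu; apply: f_inj; rewrite fv.
    by exists x0 => u fu; case: nv; exists u.
  have [h Hh] := choice inv.
  exists (fun i : 'I_(start g n) => h i) => v [u Au uv].
  by exists (Ordinal (A_nbr u v Au uv)); apply: Hh.
pose s := [seq x <- iota (start g n) (start g n.+1 - start g n) | asbool (exists v, f v = x)].
exists s; split; last first.
  move=> x Wx /eqP; rewrite block_eq => /andP[nx xn].
  by rewrite mem_filter asboolT //= mem_iota nx subnKC // ltnW ?start_lt.
rewrite leqNgt; apply/negP => /ltnW ls.
apply: (Hl (start g n) A indA _ fewN).
have us : uniq s by rewrite filter_uniq ?iota_uniq.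
have pre (i : 'I_(l (start g n))) : exists v, f v = nth 0 s i.
  have : nth 0 s i \in s by apply/mem_nth/(leq_trans (ltn_ord i)).
  by rewrite mem_filter => /andP[/asboolP].
have [h Hh] := choice pre; exists h; split.
- move=> i j hij; apply/val_inj/eqP; rewrite /= -(nth_uniq 0 _ _ us).
  + by rewrite -!Hh hij.
  + by apply: leq_trans ls.
  + by apply: leq_trans ls.
- move=> i; apply/eqP; rewrite block_eq Hh.
  have : nth 0 s i \in s by apply/mem_nth/(leq_trans (ltn_ord i)).
  by rewrite mem_filter mem_iota subnKC ?(ltnW (start_lt _ _)) // => /andP[].
Qed.

Lemma far_beyond (g : nat -> nat -> nat) (f : V -> nat) (s : seq V) n v :
  \sum_(u <- s) f u < n -> v \in s -> f v < start g n.
Proof.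
move=> fn vs; apply: leq_trans (start_ge g n); apply: leq_ltn_trans fn.
by rewrite (big_rem v) //= leq_addr.
Qed.

(** The larger end decides the colour. A vertex in a block beyond the dominating set has a neighbour
    before the block, so a block of the wrong parity is missed entirely. *)
Lemma dominated_sparse : has_finite_dominating_set adj -> sparsely_colored.
Proof.
move=> [X [[k /atmost_seq[D [_ HD]]] domX]]; pose g (_ _ : nat) := 0.
exists (fun x y => odd (block g (maxn x y))).
split=> [x y|f [f_inj _] [b fb]]; first by rewrite maxnC.
apply: (sparse_blocks (g := g)) => N; pose n := ~~ b + (N + \sum_(u <- D) f u).+1.*2.
have on : odd n = ~~ b by rewrite oddD odd_double addbF; case: (b).
exists n; split; first by rewrite /n; lia.
exists [::]; split=> // _ [v <-] fv.
have Dn : \sum_(u <- D) f u < n by rewrite /n -addnn; lia.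
have fD u : u \in D -> f u < start g n by apply: far_beyond.
have nv : start g n <= f v by rewrite -leq_block fv.
have nX : ~ X v by move=> /HD/fD; rewrite ltnNge nv.
have [u /HD/fD fu vu] := domX v nX.
have uv : f u <= f v := leq_trans (ltnW fu) nv.
by have := fb v u vu; rewrite (maxn_idPl uv) fv on; case: (b).
Qed.

(* With c x y = p (block x) + q (block y) for x < y, a block n such that
   p n differs from p (block x) shares no neighbour beyond n with x. *)
Lemma Tstar_sparse : in_Tstar adj -> sparsely_colored.
Proof.
move=> [_ [t [_ [[d Hd] [_ [_ [k /atmost_seq[D [_ HD]]]]]]]]].
pose g (_ m : nat) := m * d.
(* The second binary digit of the block number, independent of its parity. *)
pose q n := odd n./2.
exists (fun x y => odd (block g (minn x y)) (+) q (block g (maxn x y))).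
split=> [x y|f [f_inj _] [b fb]]; first by rewrite minnC maxnC.
have {fb}fb u v : adj u v -> f u <= f v -> odd (block g (f u)) (+) q (block g (f v)) = b.
  by move=> /fb + uv; rewrite (minn_idPl uv) (maxn_idPr uv).
apply: (sparse_blocks (g := g)) => N.
pose p0 := odd (block g (f t)).
(* The two low digits make [odd n] differ from the bit of [t] and give an edge from [t] into block
   [n] the wrong colour; the rest pushes the block beyond D and [t]. *)
pose n := ~~ p0 + ((~~ b (+) p0) + (N + \sum_(u <- t :: D) f u).+1.*2).*2.
have on : odd n = ~~ p0 by rewrite oddD odd_double addbF; case: (p0).
have qn : q n = ~~ b (+) p0.
  by rewrite /q half_bit_double oddD odd_double addbF; case: (~~ b (+) p0).
have Nn : N <= n by rewrite /n; lia.
have Dn : \sum_(u <- t :: D) f u < n by rewrite /n -!addnn; lia.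
have fD u : u \in t :: D -> f u < start g n by apply: far_beyond.
have ft := fD t (mem_head _ _).
have t_block v : start g n <= f v -> block g (f v) = n -> ~ adj t v.
  move=> nv fv tv; have := fb t v tv (ltnW (leq_trans ft nv)).
  by rewrite fv qn -/p0; case: (p0) (b) => -[].
have nbrs w : exists s : seq V, size s <= d /\ (w <> t -> forall x, adj w x -> x \in s).
  have [wt|wt] := pselect (w = t); first by exists [::].
  by have /atmost_seq[s [ss Hs]] := Hd w wt; exists s.
have [nb Hnb] := choice nbrs.
have inv m : exists o : option V, forall u, f u = m -> o = Some u.
  have [[v fv]|nv] := pselect (exists v, f v = m).
    by exists (Some v) => u fu; congr Some; apply: f_inj; rewrite fv.
  by exists None => u fu; case: nv; exists u.
have [h Hh] := choice inv.
pose F m := if h m is Some w then map f (nb w) else [::].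
exists n; split=> //; exists (flatten (map F (iota 0 (start g n)))); split.
  rewrite -[X in _ <= X * _](size_iota 0); apply: size_flatten_map => m.
  rewrite /F; case: (h m) => // w; rewrite size_map.
  by have [] := Hnb w.
move=> _ [v <-] fv; have nv : start g n <= f v by rewrite -leq_block fv.
(* Vertices in block [n] are at distance two from [t]. Their middle vertices [w] lie before the
   block and have degree at most [d], which leaves at most [start g n * d] of them, the value of
   [g]. *)
have [w [tw wv]] : exists w, adj t w /\ adj w v.
  apply: contrapT => nw; have /HD vD : ~ (v = t \/ adj t v \/ exists2 w, adj t w & adj w v).
    move=> [vt|[tv|[w tw wv]]].
    - by move: nv; rewrite vt leqNgt ft.
    - exact: t_block nv fv tv.
    - by apply: nw; exists w.
  by have := fD v; rewrite inE vD orbT ltnNge nv => /(_ isT).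
(* If [w] came after [v], the edges [vw] and [tw] would get different colours, as the bits of [v]
   and [t] differ; if it lay between the start of the block and [v], the edge [tw] would enter block
   [n]. *)
have wlt : f w < start g n.
  rewrite ltnNge; apply/negP => nw.
  have tw' := fb t w tw (ltnW (leq_trans ft nw)).
  have [vw|wv'] := leqP (f v) (f w).
    have := fb v w (adj_sym wv) vw; rewrite fv on -tw' -/p0.
    by case: (p0) (q _) => -[].
  apply: (t_block w nw) tw; apply/eqP; rewrite eqn_leq [_ <= block _ _]leq_block nw andbT.
  by rewrite -fv leq_block; apply: leq_trans (ltnW wv'); rewrite -leq_block.
have wt : w <> t.
  move=> wt; rewrite wt in wv; exact: t_block nv fv wv.
apply/flatten_mapP; exists (f w); first by rewrite mem_iota.
by rewrite /F (Hh (f w) w erefl) map_f //; have [_ /(_ wt)] := Hnb w; apply.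
Qed.

End Sparse.

From mathcomp Require Import all_boot all_order all_algebra.
From mathcomp Require Import all_classical all_reals.
From mathcomp Require Import topology ereal normedtype sequences Rstruct.
Import Order.TTheory GRing.Theory Num.Theory.

(** * Lower density and the theorem *)

Local Open Scope classical_set_scope.

Lemma sparse_lower_density (W : set nat) : sparse W -> ~ (0 < lower_density W)%E.
Proof.
move=> sW; rewrite /lower_density limn_einf_lim.
have := @cvg_einfs_sup _ (fun t => (density_ratio W t)%:E).
move=> /(cvg_lim (@ereal_hausdorff _)) -> /ereal_sup_gt[_ [n _ <-]].
set e := einfs _ n => e0.
have le_e t : n <= t -> (e <= (density_ratio W t)%:E)%E.
  by move=> nt; apply: ereal_inf_lbound; exists t.
case: e e0 le_e => [r| |] //; last by move=> _ /(_ n (leqnn n)).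
rewrite lte_fin => r0 le_r.
(* A positive lower density gives a bound [r] below all ratios from [n] on; a factor above both [n]
   and 1/r contradicts it. *)
have [t [Mt t0]] := sW (maxn n (Num.bound r^-1)).
have := le_r t (leq_trans (leq_maxl _ _) Mt); rewrite lee_fin /density_ratio.
set cnt := (\sum_(1 <= i < t.+1) _)%N; set M := maxn _ _.
have t0' : (0 < t%:R :> Rdefinitions.R)%R by rewrite ltr0n.
rewrite ler_pdivlMr // => rt; rewrite -(ler_nat Rdefinitions.R) natrM => Mc.
have rM : (1 < r * M%:R)%R.
  rewrite mulrC -ltr_pdivrMr // mul1r.
  apply: lt_le_trans (archi_boundP _) _; first by rewrite invr_ge0 ltW.
  by rewrite ler_nat leq_maxr.
have M0 : (0 <= M%:R :> Rdefinitions.R)%R by rewrite ler0n.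
have : (M%:R * (r * t%:R) <= t%:R :> Rdefinitions.R)%R.
  by apply: le_trans Mc; rewrite ler_wpM2l.
by rewrite mulrA [(M%:R * r)%R]mulrC leNgt ltr_pMl // rM.
Qed.

Lemma sparse_not_Ramsey (V : Type) (adj : V -> V -> Prop) (c : nat -> nat -> bool) :
  edge_coloring c ->
  (forall f : V -> nat, copy f -> monochromatic adj c f ->
    sparse (fun n => exists v, f v = n)) ->
  ~ Ramsey_lower_dense adj /\ ~ Ramsey_cofinite adj.
Proof.
move=> cc H; have range_sparse f : copy f -> monochromatic adj c f -> sparse (range f).
  move=> cf mf; have -> : (range f : nat -> Prop) = (fun n => exists v, f v = n).
    by apply/funext => n; apply/propext; split=> [[v _ <-]|[v <-]]; exists v.
  exact: H.
split=> [/(_ c cc)[f [cf [mf]]]|/(_ c cc)[f [cf [mf]]]].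
- exact: sparse_lower_density (range_sparse f cf mf).
- exact: sparse_not_cofinite (range_sparse f cf mf).
Qed.

Theorem mainTheorem6 (V : Type) (adj : V -> V -> Prop) :
  simple_graph adj -> countable_vertices V -> forest adj ->
  (strongly_contracting adj -> ~ has_finite_dominating_set adj -> ~ in_Tstar adj ->
     Ramsey_cofinite adj) /\
  (weakly_expanding adj \/ has_finite_dominating_set adj \/ in_Tstar adj ->
     ~ Ramsey_lower_dense adj /\ ~ Ramsey_cofinite adj).
Proof.
move=> [adj_sym adj_irr] [idx idx_inj] acyclic; split.
- move=> sc nd nT c c_sym.
  (* [{classic V}] equips the arbitrary type with equality and choice. *)
  have [b [f [s [f_inj f0 fc fW]]]] := @contracting_graph_spans {classic V} adj idx
    idx_inj adj_sym adj_irr acyclic c c_sym sc nd nT.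
  exists f; split; [by split|split; first by exists b].
  exists (\max_(i <- s) i).+1 => n sn.
  have [|v <-] := fW n (leq_ltn_trans (leq0n _) sn); last by exists v.
  by apply/negP => /mem_bigmax; rewrite leqNgt sn.
- move=> H; have [c [cc Hc]] : @sparsely_colored {classic V} adj.
    case: H => [we|[fd|ts]].
    + exact: expanding_sparse.
    + exact: dominated_sparse.
    + exact: Tstar_sparse.
  exact: sparse_not_Ramsey cc Hc.
Qed.
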